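(* Given $n\ge 2$, $\lambda>0$, $\Lambda>0$, $L\ge 0$, $m\ge 1$ and $A\ge 0$, there exists a constant $C=C(n,\lambda,\Lambda,L,m,A)$, depending only on these quantities, such that the following holds. Let $\omega\subset\mathbb R^{n-1}$ be a bounded Lipschitz domain, let $a_1,\dots,a_n\in\mathbb R$ with $\max_{1\le i\le n}|a_i|=A$, and let $\varphi\colon\omega\to\mathbb R$ be a Lipschitz function with Lipschitz constant $\mathrm{Lip}(\varphi)=L$, $$H=\sup_{x'\in\omega}\Big(\varphi(x')-a_1-\sum_{i=2}^na_ix_i\Big),\qquad h=\inf_{x'\in\omega}\Big(\varphi(x')-a_1-\sum_{i=2}^na_ix_i\Big)>0,\qquad \frac{H}{h}=m.$$ Let $$\Omega=\Big\{x\in\mathbb R^n : x'\in\omega,\ a_1+\sum_{i=2}^na_ix_i<x_1<\varphi(x')\Big\}.$$ Let $\mathcal L(u)=\sum_{i=1}^n b_i\,\frac{\partial^2 u}{\partial x_i^2}$ be an operator with constant real coefficients (no mixed derivatives) such that $\sum_{i=1}^n b_i\xi_i^2\ge\lambda|\xi|^2$ for all $\xi\in\mathbb R^n$ and $|b_j|\le\Lambda$ for all $1\le j\le n$. Then every $u\in C^3(\bar\Omega)$ that solves $\mathcal L(u)=0$ in $\Omega$ and satisfies $u=0$ on $\Gamma=\{x\in\partial\Omega : x'\in\partial\omega\}$ fulfills $$\|\nabla u\|_{L^2(\Omega)}^2\le\frac{C}{h}\|u\|_{L^2(\Omega)}\|u_{x_1}\|_{L^2(\Omega)}+C\|u_{x_1}\|_{L^2(\Omega)}^2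 .$$
   Context: For $x=(x_1,x_2,\dots,x_n)\in\mathbb R^n$ write $x'=(x_2,\dots,x_n)\in\mathbb R^{n-1}$. Functions are real-valued. *)

(* Defs.v *)
From HB Require Import structures.
From mathcomp Require Import all_boot all_order all_algebra.
From mathcomp Require Import all_classical all_reals all_analysis.
Set Implicit Arguments. Unset Strict Implicit. Unset Printing Implicit Defensive.
Import Order.TTheory GRing.Theory Num.Theory.
Import numFieldNormedType.Exports.
Local Open Scope classical_set_scope.
Local Open Scope ring_scope.

Definition rV_display : measure_display.
Proof. exact: (measure_tuple_display default_measure_display). Qed.

Section measurable_rV.
Context {R : realType} (n : nat).

(* The product sigma-algebra, i.e., the Borel sets of R^n; this mirrors the
   library's instance for [n.-tuple T]. *)
Let coors (i : 'I_n) (x : 'rV[R]_n) : measurableTypeR R := x ord0 i.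

Let rV_set0 : g_sigma_preimage coors set0.
Proof. exact: sigma_algebra0. Qed.

Let rV_setC A : g_sigma_preimage coors A -> g_sigma_preimage coors (~` A).
Proof. exact: sigma_algebraC. Qed.

Let rV_bigcup (F : (set 'rV[R]_n)^nat) :
  (forall i, g_sigma_preimage coors (F i)) ->
  g_sigma_preimage coors (\bigcup_i (F i)).
Proof. exact: sigma_algebra_bigcup. Qed.

HB.instance Definition _ := @isMeasurable.Build rV_display
  'rV[R]_n (g_sigma_preimage coors) rV_set0 rV_setC rV_bigcup.

Lemma measurable_coord (i : 'I_n) :
  measurable_fun [set: 'rV[R]_n] (fun x => x ord0 i : measurableTypeR R).
Proof.
move=> _ Y mY; rewrite setTI; apply: sub_sigma_algebra => /=.
rewrite -bigcup_seq/=; exists i => /=; first by rewrite mem_index_enum.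
by exists Y => //; rewrite setTI.
Qed.

Lemma measurable_fun_rVP d (T : measurableType d) (f : T -> 'rV[R]_n) :
  (forall i, measurable_fun [set: T] (fun t => f t ord0 i : measurableTypeR R)) ->
  measurable_fun [set: T] f.
Proof.
move=> mf _ A mA; rewrite setTI.
have [_ /(_ A)] : sigma_algebra setT (measurable : set (set T)) /\
    forall B : set 'rV[R]_n, measurable B -> measurable (f @^-1` B).
  split; first exact: sigma_algebra_measurable.
  apply: smallest_sub.
    split=> [|B mB|F mF] /=; first by rewrite preimage_set0.
    - by rewrite setTD preimage_setC; exact: measurableC.
    - by rewrite preimage_bigcup; exact: bigcup_measurable.
  move=> B; rewrite -bigcup_seq => -[i _ [C mC <-]] /=.
  by have := mf i measurableT C mC; rewrite !setTI.
exact.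
Qed.

End measurable_rV.

Section lebesgue_rV.
Context {R : realType}.
Implicit Type n : nat.

Definition rV_cons n (p : measurableTypeR R * 'rV[R]_n) : 'rV[R]_n.+1 :=
  \row_i (if unlift ord0 i is Some j then p.2 ord0 j else p.1).

Definition rV_uncons n (x : 'rV[R]_n.+1) : measurableTypeR R * 'rV[R]_n :=
  (x ord0 ord0, col' ord0 x).

Lemma rV_cons0 n (p : measurableTypeR R * 'rV[R]_n) :
  rV_cons p ord0 ord0 = p.1.
Proof. by rewrite mxE unlift_none. Qed.

Lemma rV_consS n (p : measurableTypeR R * 'rV[R]_n) (i : 'I_n) :
  rV_cons p ord0 (lift ord0 i) = p.2 ord0 i.
Proof. by rewrite mxE liftK. Qed.

Lemma rV_consK n : cancel (@rV_cons n) (@rV_uncons n).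
Proof.
move=> p; rewrite /rV_uncons rV_cons0; case: p => a x; congr pair.
by apply/rowP => i; rewrite mxE rV_consS.
Qed.

Lemma measurable_rV_cons n : measurable_fun setT (@rV_cons n).
Proof.
apply: measurable_fun_rVP => i.
have [->|[j ->]] : i = ord0 \/ exists j, i = lift ord0 j.
  by case: (unliftP ord0 i) => [j|] ->; [right; exists j|left].
- by under eq_fun do rewrite rV_cons0; exact: measurable_fst.
- under eq_fun do rewrite rV_consS.
  by apply: (measurableT_comp (measurable_coord j)); exact: measurable_snd.
Qed.

Lemma measurable_rV_uncons n : measurable_fun setT (@rV_uncons n).
Proof.
apply/measurable_fun_pairP; split; first exact: measurable_coord.
apply: measurable_fun_rVP => i.
by under eq_fun do rewrite /= mxE; exact: measurable_coord.
Qed.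

Section cons_lebesgue.
Local Open Scope ereal_scope.
Variables (n : nat) (mu : {sigma_finite_measure set 'rV[R]_n -> \bar R}).

Definition cons_lebesgue : set 'rV[R]_n.+1 -> \bar R :=
  pushforward (lebesgue_measure \x mu) (@rV_cons n).

Let cons0 : cons_lebesgue set0 = 0.
Proof. by rewrite /cons_lebesgue /pushforward preimage_set0 measure0. Qed.

Let cons_ge0 A : 0 <= cons_lebesgue A.
Proof. by rewrite /cons_lebesgue /pushforward measure_ge0. Qed.

Let cons_sigma_additive : semi_sigma_additive cons_lebesgue.
Proof.
move=> F mF tF mUF; rewrite /cons_lebesgue /pushforward preimage_bigcup.
have mFc k : measurable (@rV_cons n @^-1` F k).
  by rewrite -[X in measurable X]setTI; exact: measurable_rV_cons.
apply: measure_semi_sigma_additive => //; last exact: bigcup_measurable.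
apply/trivIsetP => /= i j _ _ ij; rewrite -preimage_setI.
by move/trivIsetP : tF => /(_ _ _ _ _ ij) ->//; rewrite preimage_set0.
Qed.

HB.instance Definition _ := isMeasure.Build _ _ _ cons_lebesgue
  cons0 cons_ge0 cons_sigma_additive.

Let cons_sigma_finite : sigma_finite setT cons_lebesgue.
Proof.
have /sigma_finiteP[F [TF ndF Foo]] :=
  sigma_finiteT (@lebesgue_measure R : {sigma_finite_measure set _ -> \bar R}).
have /sigma_finiteP[G [TG ndG Goo]] := sigma_finiteT mu.
exists (fun k => @rV_uncons n @^-1` (F k `*` G k)).
  rewrite -preimage_bigcup (_ : \bigcup_i _ = setT) ?preimage_setT//.
  rewrite -subTset => -[x y] _.
  have [i _ Fx] : (\bigcup_k F k) x by rewrite -TF.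
  have [j _ Gy] : (\bigcup_k G k) y by rewrite -TG.
  exists (maxn i j) => //; split.
  - by move: x Fx; exact/subsetPset/ndF/leq_maxl.
  - by move: y Gy; exact/subsetPset/ndG/leq_maxr.
move=> k; have [mF Fk] := Foo k; have [mG Gk] := Goo k; split.
  rewrite -[X in measurable X]setTI; apply: measurable_rV_uncons => //.
  exact: measurableX.
rewrite /cons_lebesgue /pushforward -comp_preimage (_ : _ \o _ = id).
  by rewrite preimage_id product_measure1E// lte_mul_pinfty// ge0_fin_numE.
by apply/funext => p; exact: rV_consK.
Qed.

HB.instance Definition _ :=
  Measure_isSigmaFinite.Build _ _ _ cons_lebesgue cons_sigma_finite.

End cons_lebesgue.

Fixpoint lebesgue_rV n : {sigma_finite_measure set 'rV[R]_n -> \bar R} :=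
  if n is n'.+1 then cons_lebesgue (lebesgue_rV n')
  else (dirac (0 : 'rV[R]_0)).

Lemma lebesgue_rV_box n (A : 'I_n -> set (measurableTypeR R)) :
  (forall i, measurable (A i)) ->
  lebesgue_rV n [set x | forall i, A i (x ord0 i)] =
  (\prod_(i < n) lebesgue_measure (A i))%E.
Proof.
elim: n A => [|n IH] A mA.
  rewrite big_ord0 /= diracE mem_set// => -[] //.
rewrite big_ord_recl -IH//.
rewrite /= /cons_lebesgue /pushforward.
rewrite -product_measure1E//.
  congr (product_measure1 _ _ _); apply/seteqP; split=> [p /= Ap|p /= [A0 A1] i].
    split=> [|i]; first by have := Ap ord0; rewrite rV_cons0.
    by have := Ap (lift ord0 i); rewrite rV_consS.
  by case: (unliftP ord0 i) => [j|] ->; rewrite ?rV_consS ?rV_cons0.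
rewrite [X in measurable X](_ : _ = \big[setI/setT]_(i < n)
    ((fun x : 'rV[R]_n => x ord0 i : measurableTypeR R) @^-1` A (lift ord0 i))).
  apply: bigsetI_measurable => i _; rewrite -[X in measurable X]setTI.
  exact: measurable_coord.
apply/seteqP; split=> x /=.
  by move=> Ax; rewrite -bigcap_seq => i _ /=; exact: Ax.
by rewrite -bigcap_seq => Ax i; apply: Ax; rewrite /= mem_index_enum.
Qed.

End lebesgue_rV.

Section geometry.
Context {R : realType}.

(* The library norm on matrices is the max norm. *)
Definition euclid_norm n (x : 'rV[R]_n) : R :=
  Num.sqrt (\sum_(i < n) x ord0 i ^+ 2).

(* Meaningful for functions that are Lipschitz on [A]: [sup] is [0] on
   unbounded sets. *)
Definition lip_const n (A : set 'rV[R]_n) (f : 'rV[R]_n -> R) : R :=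
  sup [set r | exists x y, [/\ A x, A y, x != y &
                               r = `|f x - f y| / euclid_norm (x - y)]].

Definition boundary n (A : set 'rV[R]_n) : set 'rV[R]_n :=
  closure A `\` interior A.

(* Near each boundary point, up to an orthogonal change of coordinates
   [y = x *m Q], [A] is the part of space lying above the graph of a Lipschitz
   function of all the coordinates of [y] but one; [col' i y] is [y] with its
   [i]-th coordinate removed. *)
Definition lipschitz_boundary n (A : set 'rV[R]_n) : Prop :=
  forall p, boundary A p ->
  exists (Q : 'M[R]_n) (i : 'I_n) (g : 'rV[R]_n.-1 -> R),
    [/\ Q *m Q^T = 1%:M, lipschitz g &
        \forall x \near p,
          A x <-> g (col' i (x *m Q)) < (x *m Q) ord0 i].

Definition bounded_lipschitz_domain n (A : set 'rV[R]_n) : Prop :=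
  [/\ A !=set0, open A, connected A, bounded_set A & lipschitz_boundary A].

(* Coordinates of [x : 'rV_d.+1] are [x ord0 ord0] (the distinguished
    first one) and [col' ord0 x : 'rV_d] (the remaining ones). *)

Definition affine d (a : 'I_d.+1 -> R) (y : 'rV[R]_d) : R :=
  a ord0 + \sum_(i < d) a (lift ord0 i) * y ord0 i.

Definition thin_domain d (omega : set 'rV[R]_d) (a : 'I_d.+1 -> R)
    (phi : 'rV[R]_d -> R) : set 'rV[R]_d.+1 :=
  [set x | omega (col' ord0 x) /\
           affine a (col' ord0 x) < x ord0 ord0 < phi (col' ord0 x)].

Definition lateral_boundary d (omega : set 'rV[R]_d) (a : 'I_d.+1 -> R)
    (phi : 'rV[R]_d -> R) : set 'rV[R]_d.+1 :=
  [set x | boundary (thin_domain omega a phi) x /\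
           boundary omega (col' ord0 x)].

Definition max_thickness d (omega : set 'rV[R]_d) (a : 'I_d.+1 -> R)
    (phi : 'rV[R]_d -> R) : R :=
  sup [set phi y - affine a y | y in omega].

Definition min_thickness d (omega : set 'rV[R]_d) (a : 'I_d.+1 -> R)
    (phi : 'rV[R]_d -> R) : R :=
  inf [set phi y - affine a y | y in omega].

End geometry.

Section calculus.
Context {R : realType} (n : nat).
Implicit Types (u : 'rV[R]_n -> R) (Om : set 'rV[R]_n).

Definition partial (i : 'I_n) u : 'rV[R]_n -> R :=
  fun x => 'D_(delta_mx ord0 i) u x.

Definition partials (s : seq 'I_n) u : 'rV[R]_n -> R := foldr partial u s.

(* Derivatives are only taken inside the open set [Om]; they are required to
   extend continuously to its closure. The first clause says that the values
   of [u] itself on the boundary are those of its extension. *)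
Definition Ck_closure (k : nat) Om u : Prop :=
  [/\ {within closure Om, continuous u},
      (forall (s : seq 'I_n) (i : 'I_n) x, (size s < k)%N -> Om x ->
         derivable (partials s u) x (delta_mx ord0 i)) &
      forall s : seq 'I_n, (size s <= k)%N ->
        exists v : 'rV[R]_n -> R, {within closure Om, continuous v} /\
          forall x, Om x -> partials s u x = v x].

Definition grad u (x : 'rV[R]_n) : 'rV[R]_n := \row_i partial i u x.

Definition diag_operator (b : 'I_n -> R) u (x : 'rV[R]_n) : R :=
  \sum_(i < n) b i * partial i (partial i u) x.

Definition L2norm Om u : \bar R :=
  'N[lebesgue_rV n]_2%:E [EFin \o (u \_ Om)]%E.

End calculus.

(* Main.v *)
Require Import Defs.
From HB Require Import structures.
From mathcomp Require Import all_boot all_order all_algebra.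
From mathcomp Require Import all_classical all_reals all_analysis measurable_realfun.
From mathcomp Require Import ring lra.
Set Implicit Arguments.
Unset Strict Implicit.
Unset Printing Implicit Defensive.
Import Order.TTheory GRing.Theory Num.Theory.
Import numFieldNormedType.Exports.
Local Open Scope classical_set_scope.
Local Open Scope ring_scope.

(** Write [s] for the height of a point above the affine lower face and [T] for
    the thickness of the domain over it, so that [h <= T <= m h].

    - In the strip [0 < s < h], integrating by parts against the weight
      [w = s^3 (h - s)^3] bounds the integral of [w |grad u|^2] by that of
      [|w'| |u u_1|]: the weight vanishes on the horizontal faces and [u] on the
      lateral one, while the absence of mixed derivatives makes every cross term
      a multiple of the single integral of [w' u u_1].
    - The vertical derivative [v = u_1] solves the same equation and vanishes on
      the lateral boundary, so Caccioppoli's inequality with the distance-like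
      cutoff [rho = min (s, T - s)] bounds the integral of [rho^2 |grad v|^2] by
      that of [v^2].
    - Along each vertical segment a Hardy inequality controls [f = u_i] by its
      weighted norm in the strip and by [rho f_1 = rho v_i].

    Since [T] is merely Lipschitz, integration by parts against [rho^2] is done
    as an inequality on one-dimensional slices, by monotonicity through Dini
    derivatives, which avoids the almost everywhere differentiability of [rho]. *)

(** * Lipschitz functions and one-dimensional integrals *)

(** The faces of the domain are only Lipschitz, and a line in a coordinate direction may cut it in
    infinitely many pieces. Every integration by parts is therefore done on the components of each
    one-dimensional section and then integrated by Fubini. The field must vanish at every end point
    of every component, so each field carries a factor [w], [w'], [rho] or a vertical cutoff, helped
    where needed by [u] or [u_1].

    The exponent 3 in [w] comes from integrating the derivative of [w' u^2] in direction [i]: [w'],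
    extended by zero, has to be differentiable across [s = h], with continuous derivative. That
    identity expresses the integral of [w' u u_i] through the integral of [w'' u^2], which is the
    same for all [i]; this is how [u_i] is traded for [u_1].

    On the lateral boundary [u_1] vanishes but the other [u_i] need not. They are reached through
    the vertical Hardy inequality, whose field vanishes on the two faces and whose sections avoid
    the lateral boundary; the derivative [(u_i)_1 = v_i] that it produces is the one that
    Caccioppoli controls. *)

Section lipschitz_bound.
Context {R : realType}.

Lemma lipschitz_bound_continuous (V : normedModType R) (f : V -> R) K :
  (forall x y, `|f x - f y| <= K * `|x - y|) -> continuous f.
Proof.
move=> lip x; apply/cvgrPdist_lt => e e0.
have K1 : 0 < `|K| + 1 by rewrite ltr_wpDl.
near=> y; apply: le_lt_trans (lip _ _) _.
have : `|x - y| < e / (`|K| + 1).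
  by near: y; apply: cvgr_dist_lt; rewrite ?divr_gt0//; exact: cvg_id.
rewrite ltr_pdivlMr// mulrC; apply: le_lt_trans.
by rewrite ler_wpM2r// (le_trans (ler_norm _))// lerDl.
Unshelve. all: by end_near. Qed.

Lemma norm_distD (V : normedModType R) (y x z : V) :
  `|x - z| <= `|x - y| + `|y - z|.
Proof. by rewrite -(subrKA y) (le_trans (ler_normD _ _)). Qed.

(* McShane's extension [x |-> inf_z (f z + K |x - z|)]. *)
Lemma lipschitz_bound_extension (V : normedModType R) (A : set V) (f : V -> R) K :
  0 <= K -> A !=set0 ->
  (forall x y, A x -> A y -> `|f x - f y| <= K * `|x - y|) ->
  exists g : V -> R, (forall x, A x -> g x = f x) /\
    forall x y, `|g x - g y| <= K * `|x - y|.
Proof.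
move=> K0 [z0 Az0] lip.
pose S x := [set f z + K * `|x - z| | z in A].
have S0 x : S x !=set0 by exists (f z0 + K * `|x - z0|); exists z0.
have lbS x : lbound (S x) (f z0 - K * `|x - z0|).
  move=> _ [z Az <-]; have := lip _ _ Az0 Az.
  rewrite ler_norml => /andP[_ H].
  have : K * `|z0 - z| <= K * (`|x - z0| + `|x - z|).
    by rewrite ler_wpM2l// (distrC x z0) norm_distD.
  by rewrite mulrDr; lra.
have le1 x y : inf (S x) <= inf (S y) + K * `|x - y|.
  rewrite -lerBlDr; apply: lb_le_inf => // _ [z Az <-].
  rewrite lerBlDr; apply: (@le_trans _ _ (f z + K * `|x - z|)).
    by apply: ge_inf; [exists (f z0 - K * `|x - z0|)|exists z].
  by rewrite -addrA lerD2l -mulrDr ler_wpM2l// (addrC `|y - z|) norm_distD.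
exists (fun x => inf (S x)); split => [x Ax|x y].
  apply/eqP; rewrite eq_le; apply/andP; split.
    apply: (@le_trans _ _ (f x + K * `|x - x|)).
      by apply: ge_inf; [exists (f z0 - K * `|x - z0|)|exists x].
    by rewrite subrr normr0 mulr0 addr0.
  apply: lb_le_inf => // _ [z Az <-]; rewrite -lerBlDl.
  by apply: le_trans (lip _ _ Ax Az); exact: ler_norm.
rewrite ler_norml; have h1 := le1 x y; have := le1 y x.
by rewrite distrC => h2; apply/andP; split; lra.
Qed.

End lipschitz_bound.

(** * One-sided integration by parts on open subsets of the line *)

Section one_dimensional.
Context {R : realType}.
Notation mu := (@lebesgue_measure R).

(** If [f b < f a], tilting [f] by half of its mean slope keeps the value at [b] below the values
    near [a]. At a maximum of the tilted [g] the Dini condition with [e / 2] makes [g] increase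
    strictly to the right, a contradiction. *)
Lemma dini_nondecreasing (f : R -> R) (a b : R) : a < b ->
  {within `[a, b], continuous f} ->
  (forall t, a < t < b -> forall e, 0 < e ->
     \forall dl \near 0^'+, f t - e * dl <= f (t + dl)) ->
  f a <= f b.
Proof.
move=> ab cf df; rewrite leNgt; apply/negP => fba.
pose e := (f a - f b) / (2 * (b - a)).
have ba0 : 0 < b - a by rewrite subr_gt0.
have e0 : 0 < e by rewrite divr_gt0 ?subr_gt0// mulr_gt0.
pose g t := f t + e * (t - a).
have gb : g b < f a.
  have E : e * (b - a) = (f a - f b) / 2.
    by rewrite /e invfM mulrA mulfVK// gt_eqF.
  by rewrite /g E; lra.
have [cin ca cb] := (continuous_within_itvP f ab).1 cf.
(* The Dini condition holds strictly between [a] and [b], so the maximum is sought on [[a', b]] with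
   [a < a']; [g b < g a'] keeps it away from [b]. *)
have [a' /andP[aa' a'b] ga'] : exists2 a', a < a' < b & g b < g a'.
  have : \forall x \near a^'+, g b < f x by apply: (cvgr_gt _ ca).
  move=> H; near a^'+ => x; exists x.
    by apply/andP; split; near: x; [exact: nbhs_right_gt|exact: nbhs_right_lt].
  have ax : a < x by near: x; exact: nbhs_right_gt.
  have h1 : g b < f x by near: x.
  have h2 : 0 < e * (x - a) by rewrite mulr_gt0// subr_gt0.
  by rewrite /g in h1 *; lra.
have cg : {within `[a', b], continuous g}.
  have cf' : {within `[a', b], continuous f}.
    apply: continuous_subspaceW cf; apply: subset_itvr; rewrite bnd_simp.
    exact: ltW.
  move=> x; apply: cvgD; first exact: cf'.
  apply: (@continuous_subspaceT _ _ _ (fun t => e * (t - a))) => y.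
  by apply: cvgM; [exact: cvg_cst|apply: cvgB; [exact: cvg_id|exact: cvg_cst]].
have [c cab gc] := EVT_max (ltW a'b) cg.
have gc' : g b < g c by rewrite (lt_le_trans ga')// gc// in_itv/= lexx/= ltW.
move: cab; rewrite in_itv/= => /andP[a'c cb'].
have {cb'}cb' : c < b.
  by rewrite lt_neqAle cb' andbT; apply/eqP => cE; move: gc'; rewrite cE ltxx.
have ac := lt_le_trans aa' a'c.
have e20 : 0 < e / 2 by rewrite divr_gt0.
have cab : a < c < b by rewrite ac.
near (0 : R)^'+ => dl.
have H : f c - e / 2 * dl <= f (c + dl).
  by near: dl; exact: (df c cab _ e20).
have dl0 : 0 < dl by near: dl; exact: nbhs_right_gt.
have dlb : dl < b - c by near: dl; apply: nbhs_right_lt; rewrite subr_gt0.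
have : g (c + dl) <= g c by apply: gc; rewrite in_itv/=; lra.
have K : 0 < e * dl by rewrite mulr_gt0.
by rewrite /g; lra.
Unshelve. all: by end_near. Qed.

Lemma subset_closure_itvoo (a b : R) : a < b -> `[a, b] `<=` closure `]a, b[.
Proof.
move=> ab c; rewrite /= in_itv/= => /andP[ac cb] V Vc.
have [cb'|bc] := ltP c b.
  have Vr : \forall t \near c^'+, V t by apply: cvg_within.
  near c^'+ => t; exists t; split; last by near: t.
  rewrite /= in_itv/=; apply/andP; split; last by near: t; exact: nbhs_right_lt.
  by apply: le_lt_trans ac _; near: t; exact: nbhs_right_gt.
have {}cb : c = b by apply/eqP; rewrite eq_le cb.
have Vr : \forall t \near c^'-, V t by apply: cvg_within.
near c^'- => t; exists t; split; last by near: t.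
rewrite /= in_itv/=; apply/andP; split.
  by near: t; apply: nbhs_left_gt; rewrite cb.
by rewrite -cb; near: t; exact: nbhs_left_lt.
Unshelve. all: by end_near. Qed.

Lemma open_bounded_interval (I : set R) M : open I -> is_interval I ->
  (forall x, I x -> `|x| <= M) -> I !=set0 ->
  exists a b, a < b /\ I = `]a, b[%classic.
Proof.
move=> oI iI hM1 I0.
have ub : has_ubound I.
  by exists M => x /hM1; rewrite ler_norml => /andP[].
have lb : has_lbound I.
  by exists (- M) => x /hM1; rewrite ler_norml => /andP[].
have E : I = `]inf I, sup I[%classic.
  by rewrite -(interval_bounded_interior iI lb ub) (interior_id I).1.
exists (inf I), (sup I); split=> //.
by case: I0 => x; rewrite {1}E /= in_itv/= => /andP[]; exact: lt_trans.
Qed.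

(** Half of the fundamental theorem of calculus for a non-differentiable [F]: if [P] is a primitive
    of [h], then [P - F] satisfies the Dini condition and is nondecreasing, while [F] vanishes at
    both ends. *)
Lemma Rintegral_interval_ge0 (F h : R -> R) (a b : R) : a < b ->
  mu.-integrable `[a, b] (EFin \o h) ->
  {within `[a, b], continuous F} -> F a = 0 -> F b = 0 ->
  (forall t, a < t < b -> {for t, continuous h}) ->
  (forall t, a < t < b -> forall e, 0 < e ->
     \forall dl \near 0^'+, F (t + dl) - F t <= (h t + e) * dl) ->
  0 <= \int[mu]_(x in `[a, b]) h x.
Proof.
move=> ab ih cF Fa Fb ch dF.
pose P x := parameterized_integral mu a x h.
have cP : {within `[a, b], continuous P}.
  exact: parameterized_integral_continuous (ltW ab) ih.
have : P a - F a <= P b - F b.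
  apply: (@dini_nondecreasing (fun t => P t - F t)) => //.
    by move=> x; apply: cvgB; [exact: cP|exact: cF].
  move=> t tab e e0; have /andP[at_ tb] := tab.
  have [dP P't] := continuous_FTC1_closed tb ih at_ (ch t tab).
  have {P't} : (fun dl => dl^-1 *: (P (dl *: 1 + t) - P t)) @ 0^' --> h t.
    by rewrite -P't derive1E; exact: dP.
  move=> /cvg_dnbhs_at_right/cvgr_dist_lt dP'.
  have e20 : 0 < e / 2 by rewrite divr_gt0.
  have {}dP' := dP' _ e20.
  near=> dl.
  have dl0 : 0 < dl by near: dl; exact: nbhs_right_gt.
  have H1 : F (t + dl) - F t <= (h t + e / 2) * dl.
    by near: dl; exact: dF.
  have : `|h t - dl^-1 *: (P (dl *: 1 + t) - P t)| < e / 2 by near: dl.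
  rewrite ltr_norml => /andP[_].
  rewrite -(ltr_pM2r dl0) /= mulrBl [_ *: 1]mulr1 (addrC dl t).
  rewrite /GRing.scale/= mulrAC mulVf ?gt_eqF// mul1r.
  by lra.
rewrite Fa Fb !subr0; apply: le_trans.
by rewrite /P /parameterized_integral set_itv1 Rintegral_set1.
Unshelve. all: by end_near. Qed.

(** An end point lying in [U] would belong to an open component that meets []a, b[], against
    disjointness. Hence a boundary condition on [U] is available at the ends of each component. *)
Lemma open_itv_endpoint (U : set R) (oU : open U) k (a b : R) : a < b ->
  open_disjoint_itv oU k = `]a, b[%classic ->
  (closure U a /\ ~ U a) /\ (closure U b /\ ~ U b).
Proof.
move=> ab Ek.
have sub : `]a, b[ `<=` U.
  by rewrite -Ek [X in _ `<=` X](open_disjoint_itv_bigcup oU); exact: bigcup_sup.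
have disj c : (forall V, nbhs c V -> exists t, V t /\ a < t < b) ->
    ~ (a < c < b) -> ~ U c.
  move=> Hc nc; rewrite {1}(open_disjoint_itv_bigcup oU) => -[j _ Ij].
  have /Hc[t [tj tab]] : nbhs c (open_disjoint_itv oU j).
    by apply: open_nbhs_nbhs; split => //; exact: open_disjoint_itv_open.
  have /trivIsetP/(_ j k Logic.I Logic.I) := @open_disjoint_itv_trivIset _ _ oU.
  have [jk _|jk /(_ isT)] := eqVneq j k.
    by move: Ij; rewrite jk Ek /= in_itv.
  move/seteqP => [/(_ t) + _]; apply; split => //.
  by rewrite Ek /= in_itv.
have near_in c : closure `]a, b[ c -> forall V, nbhs c V -> exists t, V t /\ a < t < b.
  by move=> cc V /cc [t [/=]]; rewrite in_itv/= => ? ?; exists t.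
have ca : closure `]a, b[ a.
  by apply: subset_closure_itvoo; rewrite //= in_itv/= lexx ltW.
have cb : closure `]a, b[ b.
  by apply: subset_closure_itvoo; rewrite //= in_itv/= lexx ltW.
split; (split; first exact: (closureS sub)); apply: disj.
- exact: near_in.
- by rewrite ltxx.
- exact: near_in.
- by rewrite ltxx andbF.
Qed.

Lemma Rintegral_open_ge0 (U : set R) M (F h : R -> R) :
  open U -> (forall x, U x -> `|x| <= M) -> mu.-integrable U (EFin \o h) ->
  {within closure U, continuous F} ->
  (forall t, closure U t -> ~ U t -> F t = 0) ->
  (forall t, U t -> {for t, continuous h}) ->
  (forall t, U t -> forall e, 0 < e ->
     \forall dl \near 0^'+, F (t + dl) - F t <= (h t + e) * dl) ->
  0 <= \int[mu]_(x in U) h x.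
Proof.
move=> oU bU ih cF F0 ch dF.
have mU : measurable U by exact: open_measurable.
rewrite /Rintegral; apply: fine_ge0.
have EU := open_disjoint_itv_bigcup oU.
set I := open_disjoint_itv oU in EU.
have mI k : measurable (I k).
  by apply: open_measurable; exact: open_disjoint_itv_open.
rewrite EU integral_bigcup//; last 2 first.
- exact: open_disjoint_itv_trivIset.
- by rewrite -EU.
apply: nneseries_ge0 => k _ _.
have [I0|/set0P I0] := eqVneq (I k) set0; first by rewrite I0 integral_set0.
have IU : I k `<=` U by rewrite EU; exact: bigcup_sup.
have [a [b [ab Ek]]] : exists a b, a < b /\ I k = `]a, b[%classic.
  apply: (@open_bounded_interval _ M) => //.
  - exact: open_disjoint_itv_open.
  - exact: open_disjoint_itv_is_interval.
  - by move=> x /IU; exact: bU.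
have [[ca Ua] [cb Ub]] := open_itv_endpoint ab Ek.
rewrite Ek in IU *.
(* [U] misses [a] and [b], and integrability is known on [U] only; the extension by 0 is integrable
   on [[a, b]], and the two end points are negligible. *)
pose h0 := h \_ U.
have ih0 : mu.-integrable setT (EFin \o h0).
  by rewrite /h0 -restrict_EFin; apply/integrable_restrict => //=; rewrite setTI.
have ihab : mu.-integrable `[a, b] (EFin \o h0).
  exact: integrableS ih0.
have : 0 <= \int[mu]_(x in `[a, b]) h0 x.
  apply: (@Rintegral_interval_ge0 F) => //.
  - apply: continuous_subspaceW cF => x /subset_closure_itvoo-/(_ ab).
    exact: (closureS IU).
  - exact: F0.
  - exact: F0.
  - move=> t tab.
    have Ut : U t by apply: IU; rewrite /= in_itv.
    have : nbhs t U by exact: open_nbhs_nbhs.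
    move=> nU; rewrite /prop_for /continuous_at {2}/h0 patchE mem_set//.
    apply: cvg_trans (ch t Ut); apply: near_eq_cvg; near=> x.
    by rewrite /h0 patchE mem_set//; near: x.
  - move=> t tab e e0.
    have Ut : U t by apply: IU; rewrite /= in_itv.
    by rewrite /h0 patchE mem_set//; exact: dF.
rewrite /Rintegral => H.
have -> : (\int[mu]_(x in `]a, b[) (h x)%:E = \int[mu]_(x in `]a, b[) (h0 x)%:E)%E.
  apply: eq_integral => x; rewrite inE => xab.
  by rewrite /= /h0 patchE mem_set//; exact: IU.
have mh0 : measurable_fun `]a, b[ (EFin \o h0).
  by apply: (measurable_int mu); apply: integrableS ih0.
have mh1 : measurable_fun `[a, b[ (EFin \o h0).
  by apply: (measurable_int mu); apply: integrableS ih0.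
rewrite integral_itv_bndo_bndc// integral_itv_obnd_cbnd; last first.
  by apply: (measurable_int mu); apply: integrableS ih0.
by rewrite -[X in (_ <= X)%E]fineK// integrable_fin_num.
Unshelve. all: by end_near. Qed.

(* The right-hand side bounds [(G rho^2)'] although [rho] need not be
   differentiable at [t]. *)
Lemma dini_product_sqr (G rho : R -> R) (g K t : R) : 0 <= K ->
  is_derive t 1 G g -> (forall x y, `|rho x - rho y| <= K * `|x - y|) ->
  0 <= rho t ->
  forall e, 0 < e -> \forall dl \near 0^'+,
    G (t + dl) * rho (t + dl) ^+ 2 - G t * rho t ^+ 2 <=
    (g * rho t ^+ 2 + 2 * K * rho t * `|G t| + e) * dl.
Proof.
move=> K0 [dG gE] lip r0 e e0.
have : (fun dl => dl^-1 *: (G (dl *: 1 + t) - G t)) @ 0^' --> g.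
  by rewrite -gE; exact: dG.
move=> /cvg_dnbhs_at_right cG.
have cr : rho (t + dl) @[dl --> 0^'+] --> rho t.
  apply/cvgrPdist_lt => e' e'0; near=> dl.
  have dl0 : 0 < dl by near: dl; exact: nbhs_right_gt.
  apply: le_lt_trans (lip _ _) _.
  rewrite opprD addrA subrr sub0r normrN gtr0_norm//.
  have : (K + 1) * dl < e'.
    rewrite -ltr_pdivlMl ?ltr_wpDl// mulrC.
    by near: dl; apply: nbhs_right_lt; rewrite divr_gt0// ltr_wpDl.
  by nra.
(* An upper bound for the difference quotient of [G rho^2]: the increment of [rho^2] factors as a
   difference times a sum, and the difference is at most [K * dl] in absolute value. *)
have c1 : (dl^-1 *: (G (dl *: 1 + t) - G t)) * rho (t + dl) ^+ 2 +
    `|G t| * (K * `|rho (t + dl) + rho t|) @[dl --> 0^'+] -->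
    g * rho t ^+ 2 + `|G t| * (K * `|rho t + rho t|).
  apply: cvgD.
    by apply: cvgM => //; under eq_fun do rewrite expr2; rewrite expr2; apply: cvgM.
  apply: cvgM; first exact: cvg_cst.
  apply: cvgM; first exact: cvg_cst.
  by apply: cvg_norm; apply: cvgD => //; exact: cvg_cst.
have H0 : g * rho t ^+ 2 + `|G t| * (K * `|rho t + rho t|) <
   g * rho t ^+ 2 + 2 * K * rho t * `|G t| + e.
  rewrite (ger0_norm (addr_ge0 r0 r0)).
  have -> : `|G t| * (K * (rho t + rho t)) = 2 * K * rho t * `|G t| by ring.
  by rewrite ltrDl.
have {}H0 := cvgr_lt _ c1 _ H0.
near=> dl.
have dl0 : 0 < dl by near: dl; exact: nbhs_right_gt.
have H : (dl^-1 *: (G (dl *: 1 + t) - G t)) * rho (t + dl) ^+ 2 +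
    `|G t| * (K * `|rho (t + dl) + rho t|) <
   g * rho t ^+ 2 + 2 * K * rho t * `|G t| + e by near: dl; exact: H0.
move: H; rewrite -(ltr_pM2r dl0) => /ltW; apply: le_trans.
have E : dl^-1 *: (G (dl *: 1 + t) - G t) * dl = G (t + dl) - G t.
  by rewrite /GRing.scale/= mulr1 mulrAC mulVf ?gt_eqF// mul1r (addrC dl).
rewrite mulrDl mulrAC E.
rewrite [X in X <= _](_ : _ = (G (t + dl) - G t) * rho (t + dl) ^+ 2 +
   G t * ((rho (t + dl) - rho t) * (rho (t + dl) + rho t))); last by ring.
rewrite lerD2l; apply: le_trans (ler_norm _) _.
rewrite !normrM -!mulrA ler_wpM2l// (mulrC _ dl) mulrA ler_wpM2r//.
apply: le_trans (lip _ _) _.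
by rewrite (addrC t) addrK gtr0_norm.
Unshelve. all: by end_near. Qed.

Lemma Rintegral_open_product_ge0 (U : set R) M (G g rho : R -> R) K : 0 <= K ->
  open U -> (forall x, U x -> `|x| <= M) ->
  mu.-integrable U (EFin \o (fun t => g t * rho t ^+ 2 + 2 * K * rho t * `|G t|)) ->
  {within closure U, continuous G} ->
  (forall x y, `|rho x - rho y| <= K * `|x - y|) ->
  (forall t, U t -> 0 <= rho t) ->
  (forall t, U t -> is_derive t 1 G (g t)) ->
  (forall t, U t -> {for t, continuous g}) ->
  (forall t, closure U t -> ~ U t -> G t * rho t = 0) ->
  0 <= \int[mu]_(t in U) (g t * rho t ^+ 2 + 2 * K * rho t * `|G t|).
Proof.
move=> K0 oU bU ih cG lip r0 dG cg G0.
have cr : continuous rho by exact: lipschitz_bound_continuous lip.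
apply: (@Rintegral_open_ge0 U M (fun t => G t * rho t ^+ 2)) => //.
- move=> x; apply: cvgM; first exact: cG.
  apply: (@continuous_subspaceT _ _ _ (fun t => rho t ^+ 2)) => y.
  by under eq_fun do rewrite expr2; apply: cvgM; exact: cr.
- by move=> t ct nt; rewrite expr2 mulrA G0// mul0r.
- move=> t Ut; apply: cvgD.
    apply: cvgM; first exact: cg.
    by under eq_fun do rewrite expr2; rewrite expr2; apply: cvgM; exact: cr.
  apply: cvgM; first by apply: cvgM; [exact: cvg_cst|exact: cr].
  apply: cvg_norm; apply: differentiable_continuous.
  by apply/derivable1_diffP; have [] := dG t Ut.
- by move=> t Ut e e0; apply: dini_product_sqr => //; [exact: dG|exact: r0].
Qed.

End one_dimensional.

(** * Measurability and slicing in R^n *)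

Section measure_rV.
Context {R : realType}.
Notation leb := (@lebesgue_rV R).

Lemma rV_ballP n (x y : 'rV[R]_n) e : 0 < e ->
  ball x e y <-> forall i, `|x ord0 i - y ord0 i| < e.
Proof.
move=> e0; split => [[_ H] i|H]; first exact: (H ord0 i).
by split=> // i j; rewrite ord1; exact: H.
Qed.

(** The sigma-algebra is generated by the coordinates and the topology by the max norm; they are
    linked by writing an open set as the union of the countably many rational cubes inside it. *)
Lemma rV_open_measurable n (A : set 'rV[R]_n) : open A -> measurable A.
Proof.
move=> oA.
pose P (p : 'rV[rat]_n * nat) : set 'rV[R]_n :=
  [set y | forall i, ball (ratr (p.1 ord0 i) : R) p.2.+1%:R^-1 (y ord0 i)].
have mP p : measurable (P p).
  rewrite (_ : P p = \big[setI/setT]_(i < n) ((fun x : 'rV[R]_n =>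
      x ord0 i : measurableTypeR R) @^-1` ball (ratr (p.1 ord0 i) : R) p.2.+1%:R^-1)).
    apply: bigsetI_measurable => i _; rewrite -[X in measurable X]setTI.
    by apply: measurable_coord => //; exact: measurable_ball.
  apply/seteqP; split=> x /=.
    by move=> Ax; rewrite -bigcap_seq => i _ /=; exact: Ax.
  by rewrite -bigcap_seq => Ax i; apply: Ax; rewrite /= mem_index_enum.
(* Cubes not contained in [A] become [set0], so that the union runs over a whole countable type. *)
pose Q p := if `[< P p `<=` A >] then P p else set0.
have -> : A = \bigcup_p Q p.
  apply/seteqP; split=> [x Ax|x [p _]]; last first.
    by rewrite /Q; case: asboolP => // PA; exact: PA.
  have : nbhs x A by exact: open_nbhs_nbhs.
  move=> /nbhs_ballP[e /= e0 eA].
  pose k := Num.truncn (2 / e).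
  have ke : k.+1%:R^-1 < e / 2.
    rewrite invf_plt ?posrE ?divr_gt0// invf_div.
    by rewrite truncnS_gt.
  clearbody k.
  have q_ i : exists q : rat, ball (ratr q : R) k.+1%:R^-1 (x ord0 i).
    have lt : x ord0 i - k.+1%:R^-1 < x ord0 i + k.+1%:R^-1.
      by rewrite ltrD2l gtrN// invr_gt0.
    have [q] := rat_in_itvoo lt; rewrite in_itv/= => /andP[q1 q2].
    exists q; rewrite /ball/= ltr_norml; by rewrite ltrBrDl q1 ltrBlDl.
  have [q Hq] := choice q_.
  exists (\row_i q i, k) => //; rewrite /Q asboolT.
    by move=> i; rewrite mxE; exact: Hq.
  move=> y Py; apply: eA; apply/rV_ballP => // i.
  have := Py i; rewrite mxE /ball/= => h1; have := Hq i; rewrite /ball/= => h2.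
  rewrite [X in `|X|](_ : _ = - (ratr (q i) - x ord0 i) + (ratr (q i) - y ord0 i)); last by ring.
  apply: le_lt_trans (ler_normD _ _) _.
  by rewrite normrN [e]splitr ltrD// ?(lt_trans h2) ?(lt_trans h1).
apply: countable_bigcupT_measurable; first exact: countableP.
by move=> p; rewrite /Q; case: ifPn.
Qed.

Lemma rV_continuous_measurable n (D : set 'rV[R]_n) (f : 'rV[R]_n -> R) :
  open D -> (forall x, D x -> {for x, continuous f}) -> measurable_fun D f.
Proof.
move=> oD cf mD; apply: (measurability _ (RGenOpens.measurableE R)) => //.
move=> _ [_ [a [b ->] <-]]; apply: rV_open_measurable.
rewrite openE => x [Dx fx].
apply: filterI; first exact: open_nbhs_nbhs.
apply: (cf x Dx); apply: open_nbhs_nbhs; split => //; exact: interval_open.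
Qed.

Definition box n (B : R) : set 'rV[R]_n :=
  [set x | forall i, `[(- B), B]%classic (x ord0 i)].

Lemma measurable_box n B : measurable (@box n B).
Proof.
rewrite (_ : @box n B = \big[setI/setT]_(i < n) ((fun x : 'rV[R]_n =>
      x ord0 i : measurableTypeR R) @^-1` `[(- B), B])).
  apply: bigsetI_measurable => i _; rewrite -[X in measurable X]setTI.
  by apply: measurable_coord.
apply/seteqP; split=> x /=.
  by move=> Ax; rewrite -bigcap_seq => i _ /=; exact: Ax.
by rewrite -bigcap_seq => Ax i; apply: Ax; rewrite /= mem_index_enum.
Qed.

Lemma lebesgue_box_lty n B : (leb n (@box n B) < +oo)%E.
Proof.
rewrite (lebesgue_rV_box (A := fun=> `[- B, B]%classic))//.
suff : (\prod_(i < n) lebesgue_measure `[(- B)%R, B]%classic)%E \is a fin_num.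
  by rewrite fin_numE ltey => /andP[].
apply: prode_fin_num => i _.
by rewrite lebesgue_measure_itv; case: ifP => // _; rewrite -EFinB.
Qed.

Lemma rV_bounded_integrable n (D : set 'rV[R]_n) (f : 'rV[R]_n -> R) M B :
  measurable D -> D `<=` box B -> measurable_fun D f ->
  (forall x, D x -> `|f x| <= M) -> (leb n).-integrable D (EFin \o f).
Proof.
move=> mD DB mf fM; apply: measurable_bounded_integrable => //.
  apply: le_lt_trans (lebesgue_box_lty n B).
  by apply: le_measure => //; rewrite inE//; exact: measurable_box.
exists M; split; first exact: num_real.
by move=> K MK x Dx; exact: le_trans (fM x Dx) (ltW MK).
Qed.

Lemma rV_consE n (t : R) (y : 'rV[R]_n) :
  rV_cons (t, y) = rV_cons (0, y) + t *: delta_mx ord0 ord0.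
Proof.
apply/rowP => i; rewrite !mxE; case: unliftP => [j ->|->] /=.
  by rewrite mulr0 addr0.
by rewrite mulr1 add0r.
Qed.

Lemma rV_cons_delta n (a t : R) (y : 'rV[R]_n) j :
  rV_cons (a, y + t *: delta_mx ord0 j) =
  rV_cons (a, y) + t *: delta_mx ord0 (lift ord0 j).
Proof.
apply/rowP => i; rewrite !mxE; case: unliftP => [k ->|->] /=.
  by rewrite !mxE eqxx/= (inj_eq lift_inj).
by rewrite mulr0 addr0.
Qed.

(** Fubini, by induction on the dimension. The measure splits off the coordinate [ord0]: if [i] is
    that coordinate, it is integrated first; otherwise it is integrated last and the induction
    hypothesis treats the inner integral. The bounds [M] and [B] supply integrability. *)
Lemma integral_slices_ge0 n (i : 'I_n) (f : 'rV[R]_n -> R) M B :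
  measurable_fun setT f -> (forall x, `|f x| <= M) ->
  (forall x, ~ box B x -> f x = 0) ->
  (forall x, 0 <= \int[lebesgue_measure]_t (f (x + t *: delta_mx ord0 i))%:E)%E ->
  (0 <= \int[leb n]_x (f x)%:E)%E.
Proof.
elim: n i f => [[]//|n IH] i f mf fM fB f0.
have intf : (leb n.+1).-integrable setT (EFin \o f).
  have : (leb n.+1).-integrable setT (EFin \o (f \_ (box B))).
    rewrite -restrict_EFin; apply/integrable_restrict => //=.
      exact: measurable_box.
    rewrite setTI; apply: (@rV_bounded_integrable _ _ _ M B) => //.
    - exact: measurable_box.
    - exact: measurable_funTS.
  apply: eq_integrable => // x _ /=; congr EFin; rewrite patchE.
  by case: ifPn => //; rewrite notin_setE => /fB.
have mc := @measurable_rV_cons R n.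
have intc : (lebesgue_measure \x leb n)%E.-integrable setT
    ((EFin \o f) \o @rV_cons R n).
  apply/integrableP; split.
    by apply: measurableT_comp => //; exact/measurable_EFinP.
  move/integrableP : intf => [_]; apply: le_lt_trans.
  rewrite /= /cons_lebesgue ge0_integral_pushforward//.
  by apply/measurable_EFinP; apply: measurableT_comp.
rewrite /= /cons_lebesgue.
rewrite (@integral_pushforward _ _ _ _ _ _ mc _ setT (EFin \o f)) //; last first.
  exact/measurable_EFinP.
rewrite preimage_setT.
case: (unliftP ord0 i) => [j|] iE.
- rewrite -integral12_prod_meas1//; apply: integral_ge0 => a _ /=.
  apply: (IH j) => //.
  + apply: measurableT_comp => //.
    apply: (measurableT_comp mc).
    exact: (@pair1_measurable _ _ (measurableTypeR R) 'rV[R]_n a).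
  + move=> y nb; apply: fB; apply: contra_not nb => b k.
    by have := b (lift ord0 k); rewrite rV_consS.
  + move=> y; have := f0 (rV_cons (a, y)).
    by rewrite iE; under eq_integral do rewrite -rV_cons_delta.
- rewrite -integral21_prod_meas1//; apply: integral_ge0 => y _ /=.
  have := f0 (rV_cons (0, y)).
  by rewrite iE; under eq_integral do rewrite -rV_consE.
Qed.

End measure_rV.

(** * Functions continuous up to the boundary *)

Section continuity_up_to_closure.
Context {R : realType}.

(** Continuity within the closure in filter form, so that the limit rules for sums and products
    apply directly. *)
Definition cont_closure n (Om : set 'rV[R]_n) (f : 'rV[R]_n -> R) : Prop :=
  forall x, closure Om x -> f @ within (closure Om) (nbhs x) --> f x.

Lemma cont_closureP n (Om : set 'rV[R]_n) f :
  {within closure Om, continuous f} <-> cont_closure Om f.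
Proof. exact: subspace_continuousP. Qed.

Context {n : nat} (Om : set 'rV[R]_n).
Implicit Types f g : 'rV[R]_n -> R.

Lemma cont_closure_cst (c : R) : cont_closure Om (fun=> c).
Proof. by move=> x _; exact: cvg_cst. Qed.

Lemma cont_closure_continuous f : continuous f -> cont_closure Om f.
Proof. by move=> cf x _; apply: cvg_within_filter; exact: cf. Qed.

Lemma cont_closureD f g : cont_closure Om f -> cont_closure Om g ->
  cont_closure Om (fun x => f x + g x).
Proof. by move=> cf cg x cx; apply: cvgD; [exact: cf|exact: cg]. Qed.

Lemma cont_closureB f g : cont_closure Om f -> cont_closure Om g ->
  cont_closure Om (fun x => f x - g x).
Proof. by move=> cf cg x cx; apply: cvgB; [exact: cf|exact: cg]. Qed.

Lemma cont_closureN f : cont_closure Om f -> cont_closure Om (fun x => - f x).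
Proof. by move=> cf x cx; apply: cvgN; exact: cf. Qed.

Lemma cont_closureM f g : cont_closure Om f -> cont_closure Om g ->
  cont_closure Om (fun x => f x * g x).
Proof. by move=> cf cg x cx; apply: cvgM; [exact: cf|exact: cg]. Qed.

Lemma cont_closureX f k : cont_closure Om f -> cont_closure Om (fun x => f x ^+ k).
Proof.
move=> cf; elim: k => [|k IH].
  by under eq_fun do rewrite expr0; exact: cont_closure_cst.
by under eq_fun do rewrite exprS; exact: cont_closureM.
Qed.

Lemma cont_closure_norm f : cont_closure Om f -> cont_closure Om (fun x => `|f x|).
Proof. by move=> cf x cx; apply: cvg_norm; exact: cf. Qed.

Lemma cont_closure_sum (I : Type) (r : seq I) (P : pred I) (F : I -> 'rV[R]_n -> R) :
  (forall i, cont_closure Om (F i)) ->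
  cont_closure Om (fun x => \sum_(i <- r | P i) F i x).
Proof.
move=> cF; elim: r => [|i r IH].
  by under eq_fun do rewrite big_nil; exact: cont_closure_cst.
under eq_fun do rewrite big_cons.
by case: (P i); [exact: cont_closureD|].
Qed.

Lemma cont_closure_interior f x : open Om -> cont_closure Om f -> Om x ->
  {for x, continuous f}.
Proof.
move=> oO cf Ox V Vx.
have H : nbhs x (fun y => closure Om y -> V (f y)) := cf x (subset_closure Ox) V Vx.
have O : nbhs x Om by exact: open_nbhs_nbhs.
apply: (filterS2 _ _ H O) => y Hy Oy.
by apply: Hy; exact: subset_closure.
Qed.

Lemma closure_box B : Om `<=` box B -> closure Om `<=` @box R n B.
Proof.
move=> OB x cx i; rewrite /= in_itv/=; apply/andP; split; rewrite leNgt;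
  apply/negP => H.
- have Hp : 0 < - B - x ord0 i by rewrite subr_gt0.
  have [y [Oy]] := cx _ (nbhsx_ballx x _ Hp).
  move=> /rV_ballP-/(_ Hp i); have := OB y Oy i.
  by rewrite /= in_itv/= ltr_norml => /andP[? ?] /andP[? ?]; lra.
- have Hp : 0 < x ord0 i - B by rewrite subr_gt0.
  have [y [Oy]] := cx _ (nbhsx_ballx x _ Hp).
  move=> /rV_ballP-/(_ Hp i); have := OB y Oy i.
  by rewrite /= in_itv/= ltr_norml => /andP[? ?] /andP[? ?]; lra.
Qed.

Lemma cont_closure_bounded B f : Om `<=` box B -> cont_closure Om f ->
  exists M, forall x, Om x -> `|f x| <= M.
Proof.
move=> OB /cont_closureP cf.
have bc : bounded_set (closure Om).
  exists `|B|; split; first exact: num_real.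
  move=> M BM x /(closure_box OB) bx.
  apply/ltW; apply: le_lt_trans BM.
  rewrite [leLHS]/Num.norm /= mx_normrE; apply/bigmax_leP; split => //= -[i j] _ /=.
  rewrite ord1; have := bx j; rewrite /= in_itv/= -ler_norml => /le_trans; apply.
  exact: ler_norm.
have [M [_ HM]] := compact_bounded (continuous_compact cf
  (bounded_closed_compact bc (@closed_closure _ Om))).
exists (M + 1) => x Ox; apply: HM; first by rewrite ltrDl.
by exists x => //; exact: subset_closure.
Qed.

Lemma cont_closure_integrable B f : open Om -> Om `<=` box B ->
  cont_closure Om f -> (lebesgue_rV n).-integrable Om (EFin \o f).
Proof.
move=> oO OB cf; have [M HM] := cont_closure_bounded OB cf.
apply: (@rV_bounded_integrable _ _ _ _ M B) => //.
- exact: rV_open_measurable.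
- by apply: rV_continuous_measurable => // x Ox; exact: cont_closure_interior.
Qed.

End continuity_up_to_closure.

Section derivative_along_lines.
Context {R : realType} {V : normedModType R}.
Implicit Types (f : V -> R) (x v : V).

Lemma is_derive_along f x v (t df : R) :
  is_derive (x + t *: v) v f df -> is_derive t 1 (fun s : R => f (x + s *: v)) df.
Proof.
move=> [dG <-].
have E : (fun h : R => h^-1 *: (((fun s => f (x + s *: v)) \o shift t) (h *: 1) -
    (fun s => f (x + s *: v)) t)) =
    (fun h => h^-1 *: ((f \o shift (x + t *: v)) (h *: v) - f (x + t *: v))).
  apply/funext => h /=; congr (_ *: (f _ - _)).
  by rewrite [h *: 1]mulr1 scalerDl addrCA.
split; first by rewrite /derivable E.
by rewrite /derive E.
Qed.

End derivative_along_lines.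

(** * The divergence theorem by slicing *)

Section slices.
Context {R : realType} {n : nat} (Om : set 'rV[R]_n) (B : R).
Hypotheses (oO : open Om) (OB : Om `<=` box B).
Notation e_ i := (delta_mx ord0 i : 'rV[R]_n).

Lemma continuous_line (x v : 'rV[R]_n) : continuous (fun t : R => x + t *: v).
Proof.
by move=> t; apply: cvgD; [exact: cvg_cst|apply: cvgZr_tmp; exact: cvg_id].
Qed.

Definition slice (x v : 'rV[R]_n) : set R := [set t | Om (x + t *: v)].

Lemma open_slice x v : open (slice x v).
Proof.
by move: (@continuous_line x v) => /continuousP; apply.
Qed.

Lemma closure_slice x v t : closure (slice x v) t -> closure Om (x + t *: v).
Proof.
move=> ct V Vx.
have [s [Os Vs]] := ct _ (@continuous_line x v t _ Vx).
by exists (x + s *: v).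
Qed.

Lemma slice_bounded x i t : slice x (e_ i) t -> `|t| <= `|B| + `|x ord0 i|.
Proof.
move=> /OB/(_ i); rewrite /= in_itv/= !mxE !eqxx mulr1 -ler_norml => H.
rewrite -[t](addrK (x ord0 i)) addrC.
by rewrite -[X in `|X|]/(- _ + _) addrC (le_trans (ler_normB _ _))// lerD2r
  addrC (le_trans H)// ler_norm.
Qed.

Lemma cont_closure_line (f : 'rV[R]_n -> R) x v : cont_closure Om f ->
  {within closure (slice x v), continuous (fun t => f (x + t *: v))}.
Proof.
move=> cf; apply/subspace_continuousP => t ct V Vt.
have H : nbhs (x + t *: v) (fun y => closure Om y -> V (f y)) :=
  cf _ (closure_slice ct) V Vt.
have {}H : nbhs t (fun s => closure Om (x + s *: v) -> V (f (x + s *: v))) :=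
  @continuous_line x v t _ H.
change (nbhs t (fun s => closure (slice x v) s -> V (f (x + s *: v)))).
by apply: filterS H => s /= Hs cs; apply: Hs; exact: closure_slice.
Qed.

(** A one-sided divergence theorem for the field [G rho^2 e_i]. The boundary condition is asked on
    the closure of each slice, not on the closure of [Om]: the Hardy inequality relies on this,
    since vertical slices stay over [omega] and never reach the lateral boundary. *)
Lemma slice_product_ge0 (i : 'I_n) (G g rho : 'rV[R]_n -> R) K : 0 <= K ->
  cont_closure Om G -> cont_closure Om g -> cont_closure Om rho ->
  (forall x t, `|rho (x + t *: e_ i) - rho x| <= K * `|t|) ->
  (forall x, Om x -> 0 <= rho x) ->
  (forall x, Om x -> is_derive x (e_ i) G (g x)) ->
  (forall x t, closure (slice x (e_ i)) t -> ~ Om (x + t *: e_ i) ->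
     G (x + t *: e_ i) * rho (x + t *: e_ i) = 0) ->
  0 <= \int[lebesgue_rV n]_(x in Om)
          (g x * rho x ^+ 2 + 2 * K * rho x * `|G x|).
Proof.
move=> K0 cG cg cr lip r0 dG G0.
set f := fun x => _.
have cf : cont_closure Om f.
  apply: cont_closureD; first by apply: cont_closureM => //; exact: cont_closureX.
  apply: cont_closureM; last exact: cont_closure_norm.
  by apply: cont_closureM => //; exact: cont_closure_cst.
have [M HM] := cont_closure_bounded OB cf.
have M0 : 0 <= `|M| by [].
have mO := rV_open_measurable oO.
rewrite Rintegral_mkcond; apply: fine_ge0.
apply: (@integral_slices_ge0 _ _ i _ `|M| B).
- apply/measurable_restrict => //; rewrite setTI.
  by apply: rV_continuous_measurable => // x Ox; have := cont_closure_interior oO cf Ox.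
- move=> x; rewrite patchE; case: ifPn => [|_]; last by rewrite normr0.
  by rewrite inE => /HM /le_trans; apply; exact: ler_norm.
- by move=> x nb; rewrite patchE memNset// => /OB.
move=> x.
have oS := @open_slice x (e_ i).
have iS : (@lebesgue_measure R).-integrable (slice x (e_ i))
    (EFin \o (fun t => f (x + t *: e_ i))).
  apply: measurable_bounded_integrable.
  - exact: open_measurable.
  - apply: (@le_lt_trans _ _ (lebesgue_measure
      `[- (`|B| + `|x ord0 i|), `|B| + `|x ord0 i|]%classic)).
      apply: le_measure; rewrite ?inE//; first exact: open_measurable.
      by move=> t /slice_bounded; rewrite /= in_itv/= ler_norml.
    by rewrite lebesgue_measure_itv; case: ifP => // _; rewrite -EFinB ltry.
  - apply: open_continuous_measurable_fun => // t; rewrite inE => St.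
    apply: (continuous_comp (@continuous_line x (e_ i) t)).
    by have := cont_closure_interior oO cf St.
  - exists M; split; first exact: num_real.
    by move=> K' MK t /HM; move/le_trans; apply; exact: ltW.
have -> : (\int[lebesgue_measure]_t ((f \_ Om) (x + t *: e_ i))%:E =
    \int[lebesgue_measure]_(t in slice x (e_ i)) (f (x + t *: e_ i))%:E)%E.
  rewrite [RHS]integral_mkcond; apply: eq_integral => t _ /=.
  rewrite !patchE; have [St|St] := pselect (slice x (e_ i) t).
    by rewrite !mem_set.
  by rewrite !memNset.
have : 0 <= \int[lebesgue_measure]_(t in slice x (e_ i)) f (x + t *: e_ i).
  apply: (@Rintegral_open_product_ge0 _ _ (`|B| + `|x ord0 i|)
    (fun t => G (x + t *: e_ i)) (fun t => g (x + t *: e_ i))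
    (fun t => rho (x + t *: e_ i))) => //.
  - by move=> t /slice_bounded.
  - exact: cont_closure_line.
  - move=> s t; have := lip (x + t *: e_ i) (s - t).
    by rewrite -addrA -scalerDl (addrC t) subrK.
  - by move=> t; exact: r0.
  - by move=> t St; apply: is_derive_along; exact: dG.
  - move=> t St; apply: (continuous_comp (@continuous_line x (e_ i) t)).
    by have := cont_closure_interior oO cg St.
  - by move=> t ct nt; exact: G0.
rewrite /Rintegral => H.
have fin : (\int[lebesgue_measure]_(t in slice x (e_ i)) (f (x + t *: e_ i))%:E)%E
    \is a fin_num.
  by apply: integrable_fin_num => //; exact: open_measurable.
by rewrite -[X in (_ <= X)%E]fineK// lee_fin.
Qed.

Lemma slice_derivative_ge0 (i : 'I_n) (G g : 'rV[R]_n -> R) :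
  cont_closure Om G -> cont_closure Om g ->
  (forall x, Om x -> is_derive x (e_ i) G (g x)) ->
  (forall x t, closure (slice x (e_ i)) t -> ~ Om (x + t *: e_ i) ->
     G (x + t *: e_ i) = 0) ->
  0 <= \int[lebesgue_rV n]_(x in Om) g x.
Proof.
move=> cG cg dG G0.
have := @slice_product_ge0 i G g (fun=> 1) 0 (lexx _) cG cg (@cont_closure_cst _ _ _ 1).
have -> : (fun x => g x * 1 ^+ 2 + 2 * 0 * 1 * `|G x|) = g.
  by apply/funext => x; rewrite expr1n mulr0 !mul0r mulr1 addr0.
apply => //.
- by move=> x t; rewrite subrr normr0 mul0r.
- by move=> x t ct nt; rewrite mulr1; exact: G0.
Qed.

(** With the constant cutoff the one-sided inequality is linear in [g], so that using it for [G] and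
    for [- G] gives equality. *)
Lemma slice_derivative_eq0 (i : 'I_n) (G g : 'rV[R]_n -> R) :
  cont_closure Om G -> cont_closure Om g ->
  (forall x, Om x -> is_derive x (e_ i) G (g x)) ->
  (forall x t, closure (slice x (e_ i)) t -> ~ Om (x + t *: e_ i) ->
     G (x + t *: e_ i) = 0) ->
  \int[lebesgue_rV n]_(x in Om) g x = 0.
Proof.
move=> cG cg dG G0; apply/eqP; rewrite eq_le; apply/andP; split.
  have : 0 <= \int[lebesgue_rV n]_(x in Om) (-1 * g x).
    apply: (@slice_derivative_ge0 i (fun x => - G x)).
    - exact: cont_closureN.
    - by apply: cont_closureM => //; exact: cont_closure_cst.
    - move=> x Ox; rewrite mulN1r.
      by have dGx := dG x Ox; apply: is_deriveN.
    - by move=> x t ct nt; rewrite G0// oppr0.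
  rewrite RintegralZl; first by rewrite mulN1r oppr_ge0.
  - exact: rV_open_measurable.
  - exact: cont_closure_integrable oO OB _.
exact: (@slice_derivative_ge0 i G).
Qed.

End slices.

(** * Symmetry of mixed partial derivatives *)

Section mixed_partials.
Context {R : realType} {V : normedModType R}.
Implicit Types (f : V -> R) (x v w : V).

Lemma MVT_along f df x v (t : R) : 0 < t ->
  (forall s, 0 <= s <= t -> is_derive (x + s *: v) v f (df (x + s *: v))) ->
  exists2 s, 0 < s < t & f (x + t *: v) - f x = t * df (x + s *: v).
Proof.
move=> t0 dfs.
have [||s] := @MVT R (fun s => f (x + s *: v)) (fun s => df (x + s *: v)) 0 t t0.
- move=> s; rewrite in_itv/= => /andP[s0 st].
  by apply: is_derive_along; apply: dfs; rewrite !ltW.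
- apply: derivable_within_continuous => s; rewrite in_itv/= => st.
  by have [] := is_derive_along (dfs s st).
rewrite in_itv/= scale0r addr0 subr0 => st ->.
by exists s => //; rewrite mulrC.
Qed.

(** The mean value theorem is used twice: along [v] for the increment of [f] by [t *: w], then along
    [w] for [fv]. *)
Lemma double_difference f fv fvw (U : set V) x v w (t : R) : 0 < t ->
  (forall a b, 0 <= a <= t -> 0 <= b <= t -> U (x + a *: v + b *: w)) ->
  (forall y, U y -> is_derive y v f (fv y)) ->
  (forall y, U y -> is_derive y w fv (fvw y)) ->
  exists a b, [/\ 0 <= a <= t, 0 <= b <= t &
    f (x + t *: v + t *: w) - f (x + t *: v) - f (x + t *: w) + f x =
    t ^+ 2 * fvw (x + a *: v + b *: w)].
Proof.
move=> t0 HU dv dw.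
have tt : 0 <= t <= t by rewrite (ltW t0) lexx.
have t00 : (0 : R) <= 0 <= t by apply/andP; split => //; exact: ltW.
pose g y := f (y + t *: w) - f y.
have [s|s /andP[s0 st] Hs] := @MVT_along g (fun y => fv (y + t *: w) - fv y) x v t t0.
  move=> st; apply: is_deriveB; last first.
    by apply: dv; have := HU s 0 st t00; rewrite scale0r addr0.
  have [dG dE] := dv _ (HU s t st tt).
  have E : (fun h : R => h^-1 *: (((fun y => f (y + t *: w)) \o shift (x + s *: v)) (h *: v) -
      f (x + s *: v + t *: w))) =
    (fun h => h^-1 *: ((f \o shift (x + s *: v + t *: w)) (h *: v) - f (x + s *: v + t *: w))).
    by apply/funext => h /=; rewrite -!addrA.
  split; first by rewrite /derivable E.
  by rewrite /derive E.
have ss : 0 <= s <= t by rewrite !ltW.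
have [b bt|b /andP[b0 bt] Hb] := @MVT_along fv fvw (x + s *: v) w t t0.
  exact/dw/HU.
exists s, b; split => //; first by rewrite !ltW.
rewrite expr2 -mulrA -Hb -Hs /g; ring.
Qed.

(** The second difference is symmetric in [v] and [w], so it yields a value of [fvw] equal to a
    value of [fwv], both at points as close to [x] as desired. *)
Lemma mixed_partials_eq f fv fw fvw fwv (U : set V) x v w : open U -> U x ->
  (forall y, U y -> is_derive y v f (fv y)) ->
  (forall y, U y -> is_derive y w f (fw y)) ->
  (forall y, U y -> is_derive y w fv (fvw y)) ->
  (forall y, U y -> is_derive y v fw (fwv y)) ->
  {for x, continuous fvw} -> {for x, continuous fwv} ->
  fvw x = fwv x.
Proof.
move=> oU Ux dv dw dvw dwv cvw cwv.
apply/eqP; rewrite -subr_eq0 -normr_le0; apply/ler_addgt0Pl => e e0; rewrite addr0.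
have e20 : 0 < e / 2 by rewrite divr_gt0.
have : \forall y \near x, [/\ U y, `|fvw x - fvw y| < e / 2 & `|fwv x - fwv y| < e / 2].
  near=> y; split; near: y.
  - exact: open_nbhs_nbhs.
  - by move/cvgrPdist_lt : cvw => /(_ _ e20).
  - by move/cvgrPdist_lt : cwv => /(_ _ e20).
move=> /nbhs_ballP[r /= r0 Hr].
(* The parallelogram with sides [t *: v] and [t *: w] then stays in the ball of radius [r]; the
   [+ 1] covers [v = w = 0]. *)
pose t := r / (2 * (`|v| + `|w| + 1)).
have N0 : 0 < `|v| + `|w| + 1 by rewrite ltr_wpDl// addr_ge0.
have t0 : 0 < t by rewrite divr_gt0// mulr_gt0.
have tN : t * (`|v| + `|w| + 1) = r / 2.
  by rewrite /t invfM mulrA mulfVK// gt_eqF.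
clearbody t.
have Hb a b : 0 <= a <= t -> 0 <= b <= t -> ball x r (x + a *: v + b *: w).
  move=> /andP[a0 at_] /andP[b0 bt].
  rewrite -ball_normE /= opprD addrA opprD addrA subrr sub0r -opprD normrN.
  apply: le_lt_trans (ler_normD _ _) _.
  rewrite !normrZ !ger0_norm//.
  apply: (@le_lt_trans _ _ (t * `|v| + t * `|w|)).
    by rewrite lerD// ler_wpM2r.
  by move: tN; rewrite !mulrDr mulr1; lra.
have [a [b [ab bb E1]]] := @double_difference f fv fvw U x v w t t0
  (fun a b ha hb => let: And3 h _ _ := Hr _ (Hb a b ha hb) in h) dv dvw.
have Hb' a' b' : 0 <= a' <= t -> 0 <= b' <= t -> U (x + a' *: w + b' *: v).
  by move=> ha hb; rewrite addrAC; have [] := Hr _ (Hb _ _ hb ha).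
have [a' [b' [ab' bb' E2]]] := @double_difference f fw fwv U x w v t t0 Hb' dw dwv.
have E : fvw (x + a *: v + b *: w) = fwv (x + b' *: v + a' *: w).
  apply: (@mulfI _ (t ^+ 2)); first by rewrite expf_neq0// gt_eqF.
  by rewrite -E1 (addrAC x (b' *: v)) -E2 (addrAC x (t *: w)); ring.
have [_ h1 _] := Hr _ (Hb _ _ ab bb).
have [_ _ h2] := Hr _ (Hb _ _ bb' ab').
rewrite E in h1.
set z := fwv (x + b' *: v + a' *: w) in h1 h2.
have -> : fvw x - fwv x = (fvw x - z) - (fwv x - z) by ring.
by rewrite (le_trans (ler_normB _ _))// [leRHS]splitr ltW// ltrD.
Unshelve. all: by end_near. Qed.

End mixed_partials.

(** * Iterated partial derivatives extended to the closure *)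

Section derivatives_up_to_closure.
Context {R : realType} {n : nat} (Om : set 'rV[R]_n).
Notation e_ i := (delta_mx ord0 i : 'rV[R]_n).

(* [U s] plays the role of the iterated partial derivative [partials s u],
   extended by continuity to [closure Om]. *)
Definition closure_jet k (U : seq 'I_n -> 'rV[R]_n -> R) : Prop :=
  (forall s, (size s <= k)%N -> cont_closure Om (U s)) /\
  (forall s i x, (size s < k)%N -> Om x -> is_derive x (e_ i) (U s) (U (i :: s) x)).

Lemma Ck_closure_jet k u : open Om -> Ck_closure k Om u ->
  exists U, [/\ closure_jet k U, forall x, closure Om x -> U [::] x = u x &
    forall s x, (size s <= k)%N -> Om x -> U s x = partials s u x].
Proof.
move=> oO [cu du ext].
have [v Hv] : {v : seq 'I_n -> 'rV[R]_n -> R &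
    forall s, (size s <= k)%N -> {within closure Om, continuous (v s)} /\
      forall x, Om x -> partials s u x = v s x}.
  apply: (@choice _ _ (fun s v => (size s <= k)%N -> {within closure Om, continuous v} /\
    forall x, Om x -> partials s u x = v x)) => s.
  have [/ext[v Hv]|_] := boolP (size s <= k)%N; first by exists v.
  by exists u.
(* Keeping [u] itself for the empty word transfers the boundary condition on [u] to the jet with no
   density argument. *)
pose U s := if s is [::] then u else v s.
have UE s x : (size s <= k)%N -> Om x -> U s x = partials s u x.
  by case: s => [//|i s] sk Ox; rewrite /U (Hv (i :: s) sk).2.
exists U; split => //; split.
  move=> [|i s] sk; apply/cont_closureP => //.
  by have [] := Hv _ sk.
move=> s i x sk Ox; rewrite UE//=.
apply: (@near_eq_is_derive _ _ _ (partials s u)).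
  have : nbhs x Om by exact: open_nbhs_nbhs.
  by apply: filterS => y Oy; rewrite UE// ltnW.
by apply: DeriveDef => //; exact: du.
Qed.

Lemma closure_jet_swap k U s i j x : open Om -> closure_jet k U ->
  (size s + 2 <= k)%N -> Om x -> U [:: i, j & s] x = U [:: j, i & s] x.
Proof.
move=> oO [cU dU]; rewrite addn2 => sk Ox.
apply: (@mixed_partials_eq _ _ (U s) (U (j :: s)) (U (i :: s)) _ _ Om x (e_ j) (e_ i)) => //.
- by move=> y Oy; apply: dU => //; exact: ltnW.
- by move=> y Oy; apply: dU => //; exact: ltnW.
- by move=> y Oy; apply: dU.
- by move=> y Oy; apply: dU.
- exact: (cont_closure_interior oO (cU [:: i, j & s] sk) Ox).
- exact: (cont_closure_interior oO (cU [:: j, i & s] sk) Ox).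
Qed.

End derivatives_up_to_closure.

(** * Geometry of the thin domain *)

Section euclidean_norm.
Context {R : realType}.

Lemma ler_coord_norm n (x : 'rV[R]_n) i : `|x ord0 i| <= `|x|.
Proof.
rewrite [leRHS]/Num.norm /= mx_normrE; apply/bigmax_geP; right => /=.
by exists (ord0, i).
Qed.

Lemma rV_norm_le n (x : 'rV[R]_n) M : 0 <= M ->
  (forall i, `|x ord0 i| <= M) -> `|x| <= M.
Proof.
move=> M0 H; rewrite [leLHS]/Num.norm /= mx_normrE.
by apply/bigmax_leP; split => //= -[i j] _ /=; rewrite ord1.
Qed.

Lemma euclid_norm_ge0 n (x : 'rV[R]_n) : 0 <= euclid_norm x.
Proof. exact: sqrtr_ge0. Qed.

Lemma euclid_norm_sqr n (x : 'rV[R]_n) :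
  euclid_norm x ^+ 2 = \sum_(i < n) x ord0 i ^+ 2.
Proof. by rewrite sqr_sqrtr// sumr_ge0// => i _; exact: sqr_ge0. Qed.

Lemma norm_le_euclid_norm n (x : 'rV[R]_n) : `|x| <= euclid_norm x.
Proof.
apply: rV_norm_le; first exact: euclid_norm_ge0.
move=> i; rewrite -(@ler_pXn2r _ 2) ?nnegrE ?euclid_norm_ge0//.
rewrite euclid_norm_sqr real_normK ?num_real// (bigD1 i)//= lerDl sumr_ge0// => j _.
exact: sqr_ge0.
Qed.

Lemma euclid_norm_le_norm n (x : 'rV[R]_n) : euclid_norm x <= n%:R * `|x|.
Proof.
rewrite -(@ler_pXn2r _ 2) ?nnegrE ?euclid_norm_ge0 ?mulr_ge0//.
rewrite euclid_norm_sqr exprMn.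
apply: (@le_trans _ _ (\sum_(i < n) `|x| ^+ 2)).
  apply: ler_sum => i _; rewrite -real_normK ?num_real//.
  by rewrite ler_pXn2r ?nnegrE// ler_coord_norm.
rewrite sumr_const card_ord -[leLHS]mulr_natl ler_wpM2r ?sqr_ge0//.
by rewrite -natrX ler_nat -{1}[n]expn1; case: n x => // n _; rewrite leq_pexp2l.
Qed.

(** The Lipschitz hypothesis bounds the quotients, so [lip_const] is a true supremum and not the
    default value of [sup]. The factor [n] converts the Euclidean norm into the max norm. *)
Lemma lip_const_bound n (A : set 'rV[R]_n) (f : 'rV[R]_n -> R) :
  [lipschitz f y | y in A] ->
  forall x y, A x -> A y -> `|f x - f y| <= lip_const A f * n%:R * `|x - y|.
Proof.
move=> [M [Mr HM]].
have [K K0 HK] : exists2 K, 0 <= K &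
    forall x y, A x -> A y -> `|f x - f y| <= K * `|x - y|.
  exists (`|M| + 1) => [|x y Ax Ay]; first by rewrite addr_ge0.
  apply: (HM _ _ (x, y)); last by [].
  by rewrite (le_lt_trans (ler_norm _))// ltrDl.
rewrite /lip_const; set S := [set r | _].
have eu0 (x y : 'rV[R]_n) : x != y -> 0 < euclid_norm (x - y).
  move=> xy; have := norm_le_euclid_norm (x - y).
  by apply: lt_le_trans; rewrite normr_gt0 subr_eq0.
have ubS : has_ubound S.
  exists K => _ [x [y [Ax Ay xy ->]]]; rewrite ler_pdivrMr ?eu0//.
  by rewrite (le_trans (HK _ _ Ax Ay))// ler_wpM2l// norm_le_euclid_norm.
move=> x y Ax Ay; have [->|xy] := eqVneq x y.
  by rewrite !subrr !normr0 mulr0.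
have : `|f x - f y| / euclid_norm (x - y) <= sup S.
  by apply: ub_le_sup => //; exists x, y.
rewrite ler_pdivrMr ?eu0// => /le_trans; apply.
rewrite -mulrA ler_wpM2l ?euclid_norm_le_norm//.
apply: (@le_trans _ _ (`|f x - f y| / euclid_norm (x - y))).
  by rewrite divr_ge0// euclid_norm_ge0.
by apply: ub_le_sup => //; exists x, y.
Qed.

End euclidean_norm.

(** * Faces, lateral boundary and vertical segments *)

Section thin_domain_geometry.
Context {R : realType} {d : nat}.
Implicit Types (a : 'I_d.+1 -> R) (psi : 'rV[R]_d -> R) (omega : set 'rV[R]_d).
Notation e_ i := (delta_mx ord0 i : 'rV[R]_d.+1).

Definition height a (x : 'rV[R]_d.+1) : R := x ord0 ord0 - affine a (col' ord0 x).

Definition thickness a psi (x : 'rV[R]_d.+1) : R :=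
  psi (col' ord0 x) - affine a (col' ord0 x).

(** The l^1 norm of the slopes, dual to the max norm. *)
Definition affine_lip a : R := \sum_(i < d) `|a (lift ord0 i)|.

Lemma affine_lip_ge0 a : 0 <= affine_lip a.
Proof. exact: sumr_ge0. Qed.

Lemma affine_lipschitz a y z : `|affine a y - affine a z| <= affine_lip a * `|y - z|.
Proof.
rewrite /affine opprD addrACA subrr add0r -sumrB.
apply: le_trans (ler_norm_sum _ _ _) _; rewrite /affine_lip mulr_suml.
apply: ler_sum => i _; rewrite -mulrBr normrM ler_wpM2l//.
by have := ler_coord_norm (y - z) i; rewrite !mxE.
Qed.

Lemma norm_col' (x y : 'rV[R]_d.+1) : `|col' ord0 x - col' ord0 y| <= `|x - y|.
Proof.
apply: rV_norm_le => // i; rewrite !mxE.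
by have := ler_coord_norm (x - y) (lift ord0 i); rewrite !mxE.
Qed.

Lemma col'_continuous : continuous (fun x : 'rV[R]_d.+1 => col' ord0 x).
Proof.
move=> x V /nbhs_ballP[e /= e0 eV].
have n : nbhs x (ball x e) by exact: nbhsx_ballx.
apply: filterS n => y xy; apply: eV; move: xy.
by rewrite -!ball_normE /=; apply: le_lt_trans; exact: norm_col'.
Qed.

Lemma shift_cvg (x v : 'rV[R]_d.+1) : (fun y => y + v) @ x --> x + v.
Proof.
move=> V /nbhs_ballP[e /= e0 eV].
have n : nbhs x (ball x e) by exact: nbhsx_ballx.
apply: filterS n => y xy; apply: eV; move: xy.
by rewrite -!ball_normE /= opprD addrACA subrr addr0.
Qed.

Lemma height_continuous a : continuous (height a).
Proof.
apply: (@lipschitz_bound_continuous _ _ _ (1 + affine_lip a)) => x y.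
rewrite /height opprB addrACA -[X in `|_ + X|]opprB.
rewrite [X in `|X|](_ : _ = (x - y) ord0 ord0 -
  (affine a (col' ord0 x) - affine a (col' ord0 y))); last by rewrite !mxE; ring.
rewrite (le_trans (ler_normB _ _))// mulrDl mul1r lerD ?ler_coord_norm//.
rewrite (le_trans (affine_lipschitz _ _ _))// ler_wpM2l ?norm_col'//.
exact: affine_lip_ge0.
Qed.

Section lipschitz_top.
Variables (omega : set 'rV[R]_d) (a : 'I_d.+1 -> R) (psi : 'rV[R]_d -> R).
Variables (K h H : R).
Hypotheses (K0 : 0 <= K) (lip : forall y z, `|psi y - psi z| <= K * `|y - z|).
Hypotheses (oo : open omega).
Notation Om := (thin_domain omega a psi).
Notation ht := (height a).
Notation th := (thickness a psi).

Lemma thickness_lipschitz x y : `|th x - th y| <= (K + affine_lip a) * `|x - y|.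
Proof.
rewrite /thickness.
rewrite [X in `|X|](_ : _ = (psi (col' ord0 x) - psi (col' ord0 y)) -
  (affine a (col' ord0 x) - affine a (col' ord0 y))); last by ring.
rewrite (le_trans (ler_normB _ _))// mulrDl lerD//.
  by rewrite (le_trans (lip _ _))// ler_wpM2l ?norm_col'.
rewrite (le_trans (affine_lipschitz _ _ _))// ler_wpM2l ?norm_col'//.
exact: affine_lip_ge0.
Qed.

Lemma thickness_continuous : continuous th.
Proof. exact: lipschitz_bound_continuous thickness_lipschitz. Qed.

Lemma gap_cvg (x : 'rV[R]_d.+1) : (fun y => th y - ht y) @ x --> th x - ht x.
Proof.
exact: (cvgB (@thickness_continuous x) (@height_continuous a x)).
Qed.

Lemma thin_domainP x : Om x <-> omega (col' ord0 x) /\ 0 < ht x < th x.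
Proof.
rewrite /thin_domain /height /thickness /=.
by rewrite subr_gt0 ltrD2r.
Qed.

Lemma thin_domain_open : open Om.
Proof.
rewrite openE => x /thin_domainP[ox /andP[h0 hT]].
have n1 : nbhs x [set y | omega (col' ord0 y)].
  by apply: col'_continuous; exact: open_nbhs_nbhs.
have n2 : nbhs x [set y | 0 < ht y].
  by have := @height_continuous a x => /cvgr_gt; apply.
have n3 : nbhs x [set y | 0 < th y - ht y].
  by have := @gap_cvg x => /cvgr_gt; apply; rewrite subr_gt0.
apply: filterS (filterI n1 (filterI n2 n3)) => y [oy [y1 y2]].
by apply/thin_domainP; split => //; rewrite y1/= -subr_gt0.
Qed.

Lemma height_line0 x (t : R) : ht (x + t *: e_ ord0) = ht x + t.
Proof.
rewrite /height.
have -> : col' ord0 (x + t *: e_ ord0) = col' ord0 x.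
  by apply/rowP => i; rewrite !mxE mulr0 addr0.
by rewrite !mxE !eqxx mulr1; ring.
Qed.

Lemma col'_line0 x (t : R) : col' ord0 (x + t *: e_ ord0) = col' ord0 x.
Proof. by apply/rowP => i; rewrite !mxE mulr0 addr0. Qed.

Lemma thickness_line0 x (t : R) : th (x + t *: e_ ord0) = th x.
Proof. by rewrite /thickness col'_line0. Qed.

Lemma height_line x i (t : R) :
  ht (x + t *: e_ (lift ord0 i)) = ht x - a (lift ord0 i) * t.
Proof.
rewrite /height !mxE /= mulr0 addr0 -addrA; congr (_ + _).
rewrite -opprD; congr (- _); rewrite /affine -addrA; congr (_ + _).
rewrite (bigD1 i)//= [in RHS](bigD1 i)//= !mxE !eqxx mulr1.
rewrite mulrDr addrAC; congr (_ + _ + _).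
apply: eq_bigr => j ji; rewrite !mxE (inj_eq lift_inj) (negbTE ji).
by rewrite mulr0 addr0.
Qed.

Lemma closure_thin_domain x : closure Om x ->
  closure omega (col' ord0 x) /\ 0 <= ht x <= th x.
Proof.
move=> cx; split.
  move=> V Vx; have [y [/thin_domainP[oy _] Vy]] := cx _ (col'_continuous Vx).
  by exists (col' ord0 y).
apply/andP; split; rewrite leNgt; apply/negP => lt0.
  have n2 : nbhs x [set y | ht y < 0].
    by have := @height_continuous a x => /cvgr_lt; apply.
  have [y [/thin_domainP[_ /andP[y0 _]] /=]] := cx _ n2.
  by rewrite ltNge ltW.
have n3 : nbhs x [set y | th y - ht y < 0].
  by have := @gap_cvg x => /cvgr_lt; apply; rewrite subr_lt0.
have [y [/thin_domainP[_ /andP[_ y0]] /=]] := cx _ n3.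
by rewrite subr_lt0 ltNge ltW.
Qed.

Lemma thickness_bounds x : (forall y, omega y -> h <= psi y - affine a y <= H) ->
  closure Om x -> h <= th x <= H.
Proof.
move=> hH cx; apply/andP; split; rewrite leNgt; apply/negP => lt0.
  have n : nbhs x [set y | th y < h].
    by have := @thickness_continuous x => /cvgr_lt; apply.
  have [y [/thin_domainP[/hH/andP[y0 _] _] /=]] := cx _ n.
  by rewrite ltNge y0.
have n : nbhs x [set y | H < th y].
  by have := @thickness_continuous x => /cvgr_gt; apply.
have [y [/thin_domainP[/hH/andP[_ y0] _] /=]] := cx _ n.
by rewrite ltNge y0.
Qed.

(** Strict height inequalities are open conditions and vertical shifts keep [x']: points of [Om]
    near [x], shifted by [t], remain in [Om] and approach the shifted point. The lateral boundary
    thus consists locally of vertical segments. *)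
Lemma lateral_boundary_line x (t : R) : closure Om x -> ~ Om x ->
  0 < ht x < th x -> 0 < ht x + t < th x ->
  lateral_boundary omega a psi (x + t *: e_ ord0).
Proof.
move=> cx nx hx hxt.
have [co _] := closure_thin_domain cx.
have no : ~ omega (col' ord0 x).
  by move=> ox; apply: nx; apply/thin_domainP.
split; last first.
  rewrite col'_line0; split => //.
  by rewrite (interior_id omega).1.
split; last first.
  rewrite (interior_id Om).1; last exact: thin_domain_open.
  by move=> /thin_domainP[]; rewrite col'_line0.
move=> V Vx.
have n0 : nbhs x [set y | V (y + t *: e_ ord0)].
  exact: shift_cvg.
case/andP: hxt => ht0 htT.
have n2 : nbhs x [set y | - t < ht y].
  by have := @height_continuous a x => /cvgr_gt; apply; lra.
have n3 : nbhs x [set y | t < th y - ht y].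
  by have := @gap_cvg x => /cvgr_gt; apply; lra.
have [y [/thin_domainP[oy yh] [Vy [/= y2 y3]]]] := cx _ (filterI n0 (filterI n2 n3)).
exists (y + t *: e_ ord0); split => //; apply/thin_domainP.
rewrite col'_line0 height_line0 thickness_line0; split => //.
by apply/andP; split; lra.
Qed.

(* [u] vanishes on the whole vertical segment through a lateral boundary point,
   hence so does its vertical derivative. *)
Lemma vertical_derivative_lateral_eq0 (u v : 'rV[R]_d.+1 -> R) :
  cont_closure Om u -> cont_closure Om v ->
  (forall x, Om x -> is_derive x (e_ ord0) u (v x)) ->
  (forall x, lateral_boundary omega a psi x -> u x = 0) ->
  forall x, closure Om x -> ~ Om x -> 0 < ht x < th x -> v x = 0.
Proof.
move=> cu cv dv u0 x cx nx hx; have /andP[h0 hT] := hx.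
apply/eqP/negPn/negP => vx0.
have c0 : 0 < `|v x| / 2 by rewrite divr_gt0// normr_gt0.
have : nbhs x (fun y => closure Om y -> `|v x - v y| < `|v x| / 2).
  have /cvgrPdist_lt := cv x cx; exact.
move=> /nbhs_ballP[r /= r0 Hr].
(* Short enough for the segment to stay in the ball where [v] is close to [v x], and below the upper
   face. *)
pose t := Num.min (r / 2) ((th x - ht x) / 2).
have t0 : 0 < t by rewrite lt_min !divr_gt0// subr_gt0.
have tr : t <= r / 2 by rewrite ge_min lexx.
have tT : t <= (th x - ht x) / 2 by rewrite ge_min lexx orbT.
clearbody t.
have hxt : 0 < ht x + t < th x by apply/andP; split; lra.
have lat0 : lateral_boundary omega a psi x.
  have := @lateral_boundary_line x 0 cx nx hx; rewrite scale0r !addr0; exact.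
have latt := lateral_boundary_line cx nx hx hxt.
(* If [u] is below [dl] in absolute value at both ends of a segment of length [t], its increment is
   below [t * (|v x| / 2)], whereas the mean value theorem makes it larger. *)
pose dl := t * (`|v x| / 2) / 2.
have dl0 : 0 < dl by rewrite divr_gt0// mulr_gt0.
have n1 : nbhs x (fun y => closure Om y -> `|u y| < dl).
  have /cvgrPdist_lt/(_ _ dl0) := cu x cx; rewrite (u0 _ lat0).
  move=> H1; have {}H1 : nbhs x (fun y => closure Om y -> `|0 - u y| < dl) := H1.
  by apply: filterS H1 => y Hy cy; have := Hy cy; rewrite sub0r normrN.
have n2 : nbhs x (fun y => closure Om (y + t *: e_ ord0) -> `|u (y + t *: e_ ord0)| < dl).
  have [[clt _] _] := latt.
  have : nbhs (x + t *: e_ ord0) (fun y => closure Om y -> `|u y| < dl).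
    have /cvgrPdist_lt/(_ _ dl0) := cu _ clt; rewrite (u0 _ latt).
    move=> H1; have {}H1 : nbhs (x + t *: e_ ord0)
      (fun y => closure Om y -> `|0 - u y| < dl) := H1.
    by apply: filterS H1 => y Hy cy; have := Hy cy; rewrite sub0r normrN.
  exact: shift_cvg.
have n3 : nbhs x [set y | t < th y - ht y].
  by have := @gap_cvg x => /cvgr_gt; apply; lra.
have n4 : nbhs x (ball x (r / 2)) by apply: nbhsx_ballx; rewrite divr_gt0.
(* Derivatives are known inside [Om] only, so the segment starts from an interior point [y] near
   [x]. *)
have [y [Oy [y1 [y2 [y3 y4]]]]] := cx _ (filterI n1 (filterI n2 (filterI n3 n4))).
have seg s : 0 <= s <= t -> Om (y + s *: e_ ord0).
  move=> /andP[s0 st]; move/thin_domainP : Oy => [oy /andP[? ?]].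
  apply/thin_domainP; rewrite col'_line0 height_line0 thickness_line0; split => //.
  by move: y3 => /= y3; apply/andP; split; lra.
have [s st|s /andP[s0 st] E] := @MVT_along _ _ u v y (e_ ord0) t t0.
  exact/dv/seg.
have Os : Om (y + s *: e_ ord0) by apply: seg; rewrite !ltW.
have : ball x r (y + s *: e_ ord0).
  rewrite [r]splitr; apply: (ball_triangle y4).
  rewrite -ball_normE /= opprD addrA subrr sub0r normrN normrZ gtr0_norm//.
  apply: (@le_lt_trans _ _ s); last exact: lt_le_trans st tr.
  rewrite ler_piMr ?(ltW s0)//; apply: rV_norm_le => // i.
  by rewrite mxE; case: (_ == _); case: (_ == _); rewrite /= ?normr1 ?normr0.
move=> /Hr/(_ (subset_closure Os)) Hv.
have {}y1 := y1 (subset_closure Oy).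
have {}y2 : `|u (y + t *: e_ ord0)| < dl.
  by apply: y2; apply: subset_closure; apply: seg; rewrite lexx ltW.
have h1 : `|v x| / 2 < `|v (y + s *: e_ ord0)|.
  have := ler_normB (v x) (v x - v (y + s *: e_ ord0)).
  have -> : v x - (v x - v (y + s *: e_ ord0)) = v (y + s *: e_ ord0) by ring.
  have := ler_distD (v (y + s *: e_ ord0)) (v x) 0; rewrite !subr0.
  by lra.
have : t * (`|v x| / 2) < t * `|v (y + s *: e_ ord0)| by rewrite ltr_pM2l.
rewrite -{2}(gtr0_norm t0) -normrM -E.
have := ler_normB (u (y + t *: e_ ord0)) (u y).
by move: y1 y2; rewrite /dl; lra.
Qed.

End lipschitz_top.

End thin_domain_geometry.

(** * Cutoff functions of the height *)

Section derivative_rules.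
Context {R : realType} {V : normedModType R}.
Implicit Types (f g : V -> R) (x v : V).

Lemma is_derive_add f g x v (df dg : R) :
  is_derive x v f df -> is_derive x v g dg ->
  is_derive x v (fun y => f y + g y) (df + dg).
Proof. by move=> hf hg; exact: is_deriveD. Qed.

Lemma is_derive_mul f g x v (df dg : R) :
  is_derive x v f df -> is_derive x v g dg ->
  is_derive x v (fun y => f y * g y) (df * g x + f x * dg).
Proof.
move=> hf hg; have h := is_deriveM hf hg; apply: (is_derive_eq h).
by rewrite addrC [g x *: df]mulrC.
Qed.

Lemma is_derive_opp f x v (df : R) :
  is_derive x v f df -> is_derive x v (fun y => - f y) (- df).
Proof. by move=> hf; exact: is_deriveN. Qed.

Lemma is_derive_const x v (c : R) : is_derive x v (fun=> c) 0.
Proof. exact: is_derive_cst. Qed.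

Lemma is_derive_of_line f x v (df : R) :
  is_derive (0 : R) 1 (fun s : R => f (x + s *: v)) df -> is_derive x v f df.
Proof.
move=> [dG <-].
have E : (fun h : R => h^-1 *: (((fun s => f (x + s *: v)) \o shift 0) (h *: 1) -
    (fun s => f (x + s *: v)) 0)) =
    (fun h => h^-1 *: ((f \o shift x) (h *: v) - f x)).
  apply/funext => h /=; congr (_ *: (f _ - f _)).
    by rewrite addr0 [h *: 1]mulr1 addrC.
  by rewrite scale0r addr0.
split; first by rewrite /derivable -E.
by rewrite /derive -E.
Qed.

Lemma is_derive_unique f x v (df dg : R) :
  is_derive x v f df -> is_derive x v f dg -> df = dg.
Proof. by move=> [_ <-] [_ <-]. Qed.

Lemma is_derive_bigsum (I : Type) (r : seq I) (F : I -> V -> R) (dF : I -> R) x v :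
  (forall i, is_derive x v (F i) (dF i)) ->
  is_derive x v (fun y => \sum_(i <- r) F i y) (\sum_(i <- r) dF i).
Proof.
move=> dFx; elim: r => [|i r IH].
  by under eq_fun do rewrite big_nil; rewrite big_nil; exact: is_derive_const.
under eq_fun do rewrite big_cons; rewrite big_cons.
exact: (is_derive_add (dFx i) IH).
Qed.

(** A directional derivative sees one line only. This allows the thickness, which is merely
    Lipschitz, to be frozen in vertical differentiation. *)
Lemma is_derive_eq_line f g x v (df : R) :
  (forall t : R, f (x + t *: v) = g (x + t *: v)) ->
  is_derive x v f df -> is_derive x v g df.
Proof.
move=> fg df_; apply: is_derive_of_line.
under eq_fun do rewrite -fg.
by apply: is_derive_along; rewrite scale0r addr0.
Qed.

End derivative_rules.

Section affine_composition.
Context {R : realType} {V : normedModType R}.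

Lemma is_derive_comp_affine (F : R -> R) (s : V -> R) x v (c dF : R) :
  (forall t : R, s (x + t *: v) = s x + c * t) ->
  is_derive (s x) 1 F dF -> is_derive x v (fun y => F (s y)) (c * dF).
Proof.
move=> sE dFx; apply: is_derive_of_line.
under eq_fun do rewrite sE.
have d1 : is_derive (0 : R) 1 (fun t => s x + c * t) c.
  have d0 := is_derive_add (@is_derive_const R R^o 0 1 (s x))
    (is_derive_mul (@is_derive_const R R^o 0 1 c) (@is_derive_id R R^o 0 1)).
  by apply: (is_derive_eq d0); rewrite mul0r !add0r mulr1.
have := @is_derive1_comp R F (fun t => s x + c * t) 0 dF c.
rewrite mulr0 addr0 => H.
by apply: (is_derive_eq (H dFx d1)); rewrite mulrC.
Qed.

End affine_composition.

Section cutoffs.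
Context {R : realType}.

Lemma is_derive_monomial (c : R) n (t : R) :
  is_derive t 1 (fun p => c * p ^+ n.+1) (c * (n.+1%:R * t ^+ n)).
Proof.
have := is_derive_poly (c *: 'X^(n.+1)) t.
rewrite derivZ derivXn hornerZ hornerMn hornerXn mulr_natl.
suff -> : horner (c *: 'X^(n.+1)) = (fun p => c * p ^+ n.+1) by [].
by apply/funext => p; rewrite hornerZ hornerXn.
Qed.

(** A polynomial in [pospart h s] whose derivative vanishes at 0 is differentiable across [s = h];
    writing the cutoffs this way avoids piecewise definitions. *)
Definition pospart (h s : R) : R := Num.max (h - s) 0.

Lemma is_derive_pospart (P P' : R -> R) (h s : R) :
  (forall t : R, is_derive t 1 P (P' t)) -> P' 0 = 0 ->
  is_derive s 1 (fun t => P (pospart h t)) (- P' (pospart h s)).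
Proof.
move=> dP P'0.
have dP1 (t : R) : is_derive t 1 (fun x => P (h - x)) (- P' (h - t)).
  rewrite -mulN1r; apply: (@is_derive_comp_affine _ _ P (fun y => h - y)) => // r.
  by rewrite mulN1r opprD addrA [r *: 1]mulr1.
rewrite /pospart; have [sh|hs] := ltP s h.
  rewrite max_l ?subr_ge0 ?ltW//.
  apply: near_eq_is_derive (dP1 s); near=> t.
  rewrite max_l// subr_ge0 ltW//; near: t; exact: lt_nbhsl.
have [hs'|hs'] := ltP h s.
  rewrite max_r ?subr_le0 ?ltW// P'0 oppr0.
  apply: near_eq_is_derive (is_derive_const s 1 (P 0)); near=> t.
  rewrite max_r// subr_le0 ltW//; near: t; exact: lt_nbhsr.
have {hs hs'}-> : s = h by apply/eqP; rewrite eq_le hs hs'.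
rewrite subrr maxxx P'0 oppr0.
have := dP1 h; rewrite subrr P'0 oppr0 => -[dh Dh].
have c0 : (fun r : R => r^-1 *: (P (h - (r *: 1 + h)) - P (h - h))) @ 0^' --> 0.
  by rewrite -[X in _ --> X]Dh; exact: dh.
(* At [s = h] each quotient is either the untruncated one, which tends to 0, or 0. *)
have c1 : (fun r : R => r^-1 *: (P (Num.max (h - (r *: 1 + h)) 0) - P (Num.max (h - h) 0)))
    @ 0^' --> 0.
  apply/cvgrPdist_lt => e e0; move/cvgrPdist_lt : c0 => /(_ e e0).
  apply: filterS => r; rewrite subrr maxxx.
  by case: (leP 0 (h - (r *: 1 + h))) => // _ _; rewrite !subrr scaler0 subrr normr0.
split; first by apply/cvg_ex; exists 0; exact: c1.
by apply/cvg_lim => //; exact: c1.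
Unshelve. all: by end_near. Qed.

Lemma pospart_bounds (h s : R) : 0 < h -> 0 <= s -> 0 <= pospart h s <= h.
Proof.
move=> h0 s0; rewrite /pospart le_max lexx orbT /= ge_max (ltW h0) andbT.
by rewrite gerBl.
Qed.

Lemma pospart_ge (h s : R) : h <= s -> pospart h s = 0.
Proof. by move=> hs; rewrite /pospart max_r// subr_le0. Qed.

Lemma pospart0 (h : R) : 0 < h -> pospart h 0 = h.
Proof. by move=> h0; rewrite /pospart subr0 max_l// ltW. Qed.

Lemma pospart_continuous (h : R) : continuous (pospart h).
Proof.
move=> s; apply: (@continuous_max _ _ (fun s => h - s) (fun=> 0)); last exact: cvg_cst.
by apply: cvgB; [exact: cvg_cst|exact: cvg_id].
Qed.

(* [strip_weight h s] is [s^3 (h - s)^3] for [s <= h] and [0] beyond; the next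
   two functions are its derivatives, and [strip_primitive] is minus a
   primitive. *)
Definition strip_weight (h s : R) : R :=
  (h - pospart h s) ^+ 3 * pospart h s ^+ 3.

Definition strip_weight1 (h s : R) : R :=
  - (3 * (h - pospart h s) ^+ 2 * pospart h s ^+ 2 * (h - 2 * pospart h s)).

Definition strip_weight2 (h s : R) : R :=
  6 * h ^+ 3 * pospart h s - 36 * h ^+ 2 * pospart h s ^+ 2
  + 60 * h * pospart h s ^+ 3 - 30 * pospart h s ^+ 4.

Definition strip_primitive (h s : R) : R :=
  h ^+ 3 / 4 * pospart h s ^+ 4 - 3 * h ^+ 2 / 5 * pospart h s ^+ 5
  + h / 2 * pospart h s ^+ 6 - 7^-1 * pospart h s ^+ 7.

Lemma is_derive_poly4 (c1 c2 c3 c4 : R) n1 n2 n3 n4 (t : R) :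
  is_derive t 1 (fun p => c1 * p ^+ n1.+1 + c2 * p ^+ n2.+1 + c3 * p ^+ n3.+1
     + c4 * p ^+ n4.+1)
  (c1 * (n1.+1%:R * t ^+ n1) + c2 * (n2.+1%:R * t ^+ n2) +
   c3 * (n3.+1%:R * t ^+ n3) + c4 * (n4.+1%:R * t ^+ n4)).
Proof.
by apply: is_derive_add; [apply: is_derive_add; [apply: is_derive_add|]|];
  exact: is_derive_monomial.
Qed.

Lemma is_derive_strip_weight (h s : R) :
  is_derive s 1 (strip_weight h) (strip_weight1 h s).
Proof.
(* The expansion of [(h - p)^3 p^3] in powers of [p]. *)
have := @is_derive_pospart (fun p => h ^+ 3 * p ^+ 3 + (- 3 * h ^+ 2) * p ^+ 4
    + (3 * h) * p ^+ 5 + (-1) * p ^+ 6) _ h s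
  (is_derive_poly4 (h ^+ 3) (- 3 * h ^+ 2) (3 * h) (-1) 2 3 4 5).
move=> /(_ _)/wrap[]; first by rewrite !expr0n /= !mulr0 !addr0.
have -> : strip_weight h = (fun t => h ^+ 3 * pospart h t ^+ 3
   + (- 3 * h ^+ 2) * pospart h t ^+ 4
    + (3 * h) * pospart h t ^+ 5 + (-1) * pospart h t ^+ 6).
  by apply/funext => t; rewrite /strip_weight; ring.
by move/is_derive_eq; apply; rewrite /strip_weight1; ring.
Qed.

Lemma is_derive_strip_weight1 (h s : R) :
  is_derive s 1 (strip_weight1 h) (strip_weight2 h s).
Proof.
have := @is_derive_pospart (fun p => (- 3 * h ^+ 3) * p ^+ 2 + (12 * h ^+ 2) * p ^+ 3
    + (- 15 * h) * p ^+ 4 + 6 * p ^+ 5) _ h s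
  (is_derive_poly4 (- 3 * h ^+ 3) (12 * h ^+ 2) (- 15 * h) 6 1 2 3 4).
move=> /(_ _)/wrap[]; first by rewrite !expr0n /= !mulr0 !addr0.
have -> : strip_weight1 h = (fun t => (- 3 * h ^+ 3) * pospart h t ^+ 2
    + (12 * h ^+ 2) * pospart h t ^+ 3
    + (- 15 * h) * pospart h t ^+ 4 + 6 * pospart h t ^+ 5).
  by apply/funext => t; rewrite /strip_weight1; ring.
by move/is_derive_eq; apply; rewrite /strip_weight2; ring.
Qed.

Lemma is_derive_strip_primitive (h s : R) :
  is_derive s 1 (strip_primitive h) (- strip_weight h s).
Proof.
have := @is_derive_pospart (fun p => (h ^+ 3 / 4) * p ^+ 4 + (- (3 * h ^+ 2 / 5)) * p ^+ 5
    + (h / 2) * p ^+ 6 + (- 7^-1) * p ^+ 7) _ h s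
  (is_derive_poly4 (h ^+ 3 / 4) (- (3 * h ^+ 2 / 5)) (h / 2) (- 7^-1) 3 4 5 6).
move=> /(_ _)/wrap[]; first by rewrite !expr0n /= !mulr0 !addr0.
have -> : strip_primitive h = (fun t => (h ^+ 3 / 4) * pospart h t ^+ 4
    + (- (3 * h ^+ 2 / 5)) * pospart h t ^+ 5
    + (h / 2) * pospart h t ^+ 6 + (- 7^-1) * pospart h t ^+ 7).
  by apply/funext => t; rewrite /strip_primitive; ring.
by move/is_derive_eq; apply; rewrite /strip_weight; field.
Qed.

Lemma strip_continuous (h : R) :
  [/\ continuous (strip_weight h), continuous (strip_weight1 h),
      continuous (strip_weight2 h) & continuous (strip_primitive h)].
Proof.
have cX n (c : R) : continuous (fun s => c * pospart h s ^+ n).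
  move=> s; apply: cvgM; first exact: cvg_cst.
  apply: (@continuous_comp _ _ _ (pospart h) (fun x => x ^+ n)).
    exact: pospart_continuous.
  exact: exprn_continuous.
have dc (f f' : R -> R) : (forall s : R, is_derive s 1 f (f' s)) -> continuous f.
  move=> df s; apply/differentiable_continuous/derivable1_diffP.
  by have [] := df s.
split.
- exact: dc (is_derive_strip_weight h).
- exact: dc (is_derive_strip_weight1 h).
- have c1 s := cX 1%N (6 * h ^+ 3) s.
  have c2 s := cX 2%N (36 * h ^+ 2) s.
  have c3 s := cX 3%N (60 * h) s.
  have c4 s := cX 4%N 30 s.
  by move=> s; exact: (cvgB (cvgD (cvgB (c1 s) (c2 s)) (c3 s)) (c4 s)).
- exact: dc (is_derive_strip_primitive h).
Qed.

Lemma strip_weight_bounds (h s : R) : 0 < h -> 0 <= s -> 0 <= strip_weight h s <= h ^+ 6.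
Proof.
move=> h0 s0; have /andP[p0 ph] := pospart_bounds h0 s0.
have q0 : 0 <= h - pospart h s by rewrite subr_ge0.
have qh : h - pospart h s <= h by rewrite gerBl.
have hh := ltW h0.
rewrite /strip_weight mulr_ge0 ?exprn_ge0//=.
have -> : h ^+ 6 = h ^+ 3 * h ^+ 3 by ring.
by apply: ler_pM; rewrite ?exprn_ge0//; apply: lerXn2r.
Qed.

Lemma strip_weight1_bound (h s : R) : 0 < h -> 0 <= s ->
  `|strip_weight1 h s| <= 3 * h ^+ 5.
Proof.
move=> h0 s0; have /andP[p0 ph] := pospart_bounds h0 s0.
rewrite /strip_weight1 normrN !normrM.
have q0 : 0 <= h - pospart h s by rewrite subr_ge0.
have qh : h - pospart h s <= h by rewrite gerBl.
have hh := ltW h0.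
have -> : 3 * h ^+ 5 = 3 * h ^+ 2 * h ^+ 2 * h by ring.
have H1 : `|(h - pospart h s) ^+ 2| <= h ^+ 2.
  by rewrite ger0_norm ?sqr_ge0//; apply: lerXn2r.
have H2 : `|pospart h s ^+ 2| <= h ^+ 2.
  by rewrite ger0_norm ?sqr_ge0//; apply: lerXn2r.
have H3 : `|h - 2 * pospart h s| <= h.
  by rewrite ler_norml; apply/andP; split; lra.
rewrite -!expr2 (ger0_norm (_ : 0 <= 3 :> R))//.
have H4 : 3 * `|(h - pospart h s) ^+ 2| <= 3 * h ^+ 2 by rewrite ler_wpM2l.
have H5 : 3 * `|(h - pospart h s) ^+ 2| * `|pospart h s ^+ 2| <=
    3 * h ^+ 2 * h ^+ 2.
  by rewrite (ler_pM _ _ H4 H2)// mulr_ge0.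
have H6 : 3 * `|(h - pospart h s) ^+ 2| * `|pospart h s ^+ 2| *
    `|h - 2 * pospart h s| <= 3 * h ^+ 2 * h ^+ 2 * h.
  by rewrite (ler_pM _ _ H5 H3)// !mulr_ge0.
by move: H6; rewrite !normrX.
Qed.

Lemma strip_weight_eq0 (h s : R) : 0 < h -> s = 0 \/ h <= s ->
  strip_weight h s = 0 /\ strip_weight1 h s = 0.
Proof.
move=> h0 [->|hs]; rewrite /strip_weight /strip_weight1.
  by rewrite pospart0// subrr !expr0n /= !(mulr0, mul0r) oppr0.
by rewrite pospart_ge// !expr0n /= !(mulr0, mul0r) oppr0.
Qed.

Lemma strip_primitive0 (h : R) : 0 < h -> strip_primitive h 0 = h ^+ 7 / 140.
Proof. by move=> h0; rewrite /strip_primitive pospart0//; field. Qed.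

Lemma strip_primitive_ge (h s : R) : h <= s -> strip_primitive h s = 0.
Proof. by move=> hs; rewrite /strip_primitive pospart_ge// !expr0n /=; ring. Qed.

(* A function of the height [s] vanishing at [s = 0] and [s = T], whose
   derivative is [1] outside the strip [0 < s < h]; the factor [140] is the
   inverse of the integral of [s^3 (1 - s)^3] over [0, 1]. *)
Definition vertical_field (h T s : R) : R :=
  s - T + 140 * T / h ^+ 7 * strip_primitive h s.

Lemma is_derive_vertical_field (h T s : R) :
  is_derive s 1 (vertical_field h T) (1 - 140 * T / h ^+ 7 * strip_weight h s).
Proof.
have d1 := is_derive_add (@is_derive_id R R^o s 1) (@is_derive_const R R^o s 1 (- T)).
have d2 := is_derive_mul (@is_derive_const R R^o s 1 (140 * T / h ^+ 7))
  (is_derive_strip_primitive h s).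
apply: (is_derive_eq (is_derive_add d1 d2)).
by rewrite mul0r add0r addr0 mulrN.
Qed.

Lemma vertical_field0 (h T : R) : 0 < h -> vertical_field h T 0 = 0.
Proof.
by move=> h0; rewrite /vertical_field strip_primitive0//; field; rewrite gt_eqF.
Qed.

Lemma vertical_fieldT (h T : R) : h <= T -> vertical_field h T T = 0.
Proof.
by move=> hT; rewrite /vertical_field strip_primitive_ge// subrr add0r mulr0.
Qed.

(** The field vanishes at 0 and at [T], and its derivative is at most [1 + 140 * m] because the
    weight is at most [h^6] and [T <= m * h]. The mean value theorem from each end gives the
    distance to the nearer one. *)
Lemma vertical_field_bound (h T m s : R) : 0 < h -> h <= T <= m * h -> 0 <= s <= T ->
  `|vertical_field h T s| <= (1 + 140 * m) * Num.min s (T - s).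
Proof.
move=> h0 /andP[hT Tm] /andP[s0 sT].
have B r : 0 <= r -> `|1 - 140 * T / h ^+ 7 * strip_weight h r| <= 1 + 140 * m.
  move=> r0; have /andP[w0 wh] := strip_weight_bounds h0 r0.
  rewrite (le_trans (ler_normB _ _))// normr1 lerD2l ger0_norm; last first.
    by rewrite mulr_ge0// divr_ge0 ?exprn_ge0 ?ltW// mulr_gt0// (lt_le_trans h0).
  have h7 : 0 < h ^+ 7 by rewrite exprn_gt0.
  rewrite mulrAC ler_pdivrMr//.
  apply: (@le_trans _ _ (140 * (m * h) * h ^+ 6)).
    have T0 : 0 <= T by rewrite (le_trans (ltW h0)).
    have HT : 140 * T <= 140 * (m * h) by rewrite ler_wpM2l.
    by rewrite (ler_pM _ _ HT wh)// mulr_ge0.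
  by rewrite le_eqVlt; apply/orP; left; apply/eqP; ring.
have mvt r1 r2 : 0 <= r1 -> r1 <= r2 ->
    `|vertical_field h T r2 - vertical_field h T r1| <= (1 + 140 * m) * (r2 - r1).
  move=> r10 r12.
  have [||r] := @MVT_segment R (vertical_field h T)
    (fun s => 1 - 140 * T / h ^+ 7 * strip_weight h s) r1 r2 r12.
  - by move=> r _; exact: is_derive_vertical_field.
  - apply: derivable_within_continuous => r _.
    by have [] := is_derive_vertical_field h T r.
  rewrite in_itv/= => /andP[r1r _] ->.
  by rewrite normrM (ger0_norm (_ : 0 <= r2 - r1)) ?subr_ge0// ler_wpM2r ?subr_ge0//
    B// (le_trans r10).
have := mvt 0 s (lexx _) s0; rewrite vertical_field0// !subr0 => h1.
have := mvt s T s0 sT; rewrite vertical_fieldT// sub0r normrN => h2.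
by rewrite /Num.min; case: ifP.
Qed.

End cutoffs.

(** * Energy estimates *)

Section integral_rules.
Context {R : realType} {n : nat} (Om : set 'rV[R]_n) (B : R).
Hypotheses (oO : open Om) (OB : Om `<=` box B).
Notation J f := (\int[lebesgue_rV n]_(x in Om) f x).
Implicit Types f g : 'rV[R]_n -> R.

Lemma cont_integralD f g : cont_closure Om f -> cont_closure Om g ->
  J (fun x => f x + g x) = J f + J g.
Proof.
move=> cf cg; rewrite RintegralD//; first exact: rV_open_measurable.
- exact: cont_closure_integrable OB _.
- exact: cont_closure_integrable OB _.
Qed.

Lemma cont_integralZ c f : cont_closure Om f -> J (fun x => c * f x) = c * J f.
Proof.
move=> cf; rewrite RintegralZl//; first exact: rV_open_measurable.
exact: cont_closure_integrable OB _.
Qed.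

Lemma cont_integral_sum (I : Type) (r : seq I) (F : I -> 'rV[R]_n -> R) :
  (forall i, cont_closure Om (F i)) ->
  J (fun x => \sum_(i <- r) F i x) = \sum_(i <- r) J (F i).
Proof.
move=> cF; elim: r => [|i r IH].
  under eq_Rintegral do rewrite big_nil; rewrite big_nil.
  by have := cont_integralZ 0 (@cont_closure_cst _ _ Om 0); rewrite !mul0r.
under eq_Rintegral do rewrite big_cons; rewrite big_cons -IH cont_integralD//.
exact: cont_closure_sum.
Qed.

Lemma le_cont_integral f g : cont_closure Om f -> cont_closure Om g ->
  (forall x, Om x -> f x <= g x) -> J f <= J g.
Proof.
move=> cf cg fg; apply: le_Rintegral => //; first exact: rV_open_measurable.
- exact: cont_closure_integrable OB _.
- exact: cont_closure_integrable OB _.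
Qed.

Lemma eq_cont_integral f g : (forall x, Om x -> f x = g x) -> J f = J g.
Proof. by move=> fg; apply: eq_Rintegral => x; rewrite inE; exact: fg. Qed.

Lemma cont_integral0 f : (forall x, Om x -> f x = 0) -> J f = 0.
Proof.
move=> f0; rewrite (@eq_cont_integral f (fun=> 0 * 0)) => [|x Ox].
  by rewrite cont_integralZ ?mul0r//; exact: cont_closure_cst.
by rewrite f0// mulr0.
Qed.

Lemma cont_integral_ge0 f : (forall x, Om x -> 0 <= f x) -> 0 <= J f.
Proof. exact: Rintegral_ge0. Qed.

Lemma cont_integral_Cauchy_Schwarz f g : cont_closure Om f -> cont_closure Om g ->
  J (fun x => `|f x * g x|) <=
  Num.sqrt (J (fun x => f x ^+ 2)) * Num.sqrt (J (fun x => g x ^+ 2)).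
Proof.
move=> cf cg.
set F := J (fun x => f x ^+ 2); set G := J (fun x => g x ^+ 2).
set P := J (fun x => `|f x * g x|).
have F0 : 0 <= F by apply: cont_integral_ge0 => x _; exact: sqr_ge0.
have G0 : 0 <= G by apply: cont_integral_ge0 => x _; exact: sqr_ge0.
have P0 : 0 <= P by apply: cont_integral_ge0.
(* discriminant of the nonnegative quadratic form [J (t |f| - |g|)^2] *)
have quad (t : R) : 0 <= t ^+ 2 * F + (- (2 * t)) * P + G.
  have -> : t ^+ 2 * F + (- (2 * t)) * P + G =
      J (fun x => t ^+ 2 * f x ^+ 2 + (- (2 * t)) * `|f x * g x| + g x ^+ 2).
    have c1 := @cont_closureX _ _ Om f 2 cf.
    have c2 := cont_closure_norm (cont_closureM cf cg).
    have c3 := @cont_closureX _ _ Om g 2 cg.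
    have c4 := cont_closureM (@cont_closure_cst _ _ Om (t ^+ 2)) c1.
    have c5 := cont_closureM (@cont_closure_cst _ _ Om (- (2 * t))) c2.
    rewrite (cont_integralD (cont_closureD c4 c5) c3) (cont_integralD c4 c5).
    by rewrite (cont_integralZ (t ^+ 2) c1) (cont_integralZ (- (2 * t)) c2).
  apply: cont_integral_ge0 => x _.
  have -> : t ^+ 2 * f x ^+ 2 + (- (2 * t)) * `|f x * g x| + g x ^+ 2 =
      (t * `|f x| - `|g x|) ^+ 2.
    rewrite normrM -[f x ^+ 2]real_normK ?num_real// -[g x ^+ 2]real_normK ?num_real//.
    by ring.
  exact: sqr_ge0.
rewrite -sqrtrM// -[leLHS](ger0_norm P0) -sqrtr_sqr ler_wsqrtr//.
have [F00|Fn0] := eqVneq F 0.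
  have [->|Pn0] := eqVneq P 0; first by rewrite expr0n /= mulr_ge0.
  (* For [F = 0] the form is affine in [t], and equals [-1] at this point. *)
  have := quad ((G + 1) / (2 * P)); rewrite F00 mulr0 add0r.
  have -> : - (2 * ((G + 1) / (2 * P))) * P = - (G + 1) by field.
  by lra.
(* The minimizer of the form. *)
have := quad (P / F).
have -> : (P / F) ^+ 2 * F + - (2 * (P / F)) * P + G = G - P ^+ 2 / F by field.
by rewrite subr_ge0 ler_pdivrMr 1?mulrC// lt_def Fn0.
Qed.

End integral_rules.

(** * Strip identity, Caccioppoli inequality and Hardy inequality *)

Section energy.
Context {R : realType} {d : nat}.
Variables (omega : set 'rV[R]_d) (a : 'I_d.+1 -> R) (psi : 'rV[R]_d -> R).
Variables (K h m B lam Lam : R) (b : 'I_d.+1 -> R).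
Variable U : seq 'I_d.+1 -> 'rV[R]_d.+1 -> R.
Notation Om := (thin_domain omega a psi).
Notation ht := (height a).
Notation th := (thickness a psi).
Notation e_ i := (delta_mx ord0 i : 'rV[R]_d.+1).
Notation J f := (\int[lebesgue_rV d.+1]_(x in Om) f x).
Hypotheses (K0 : 0 <= K) (lip : forall y z, `|psi y - psi z| <= K * `|y - z|).
Hypotheses (oo : open omega) (OB : Om `<=` box B).
Hypotheses (h0 : 0 < h) (hT : forall x, closure Om x -> h <= th x <= m * h).
Hypothesis jet : closure_jet Om 3 U.
Hypothesis lat : forall x, lateral_boundary omega a psi x -> U [::] x = 0.
Hypothesis eqn : forall x, Om x -> \sum_i b i * U [:: i; i] x = 0.
Hypotheses (lam0 : 0 < lam) (bl : forall i, lam <= b i <= Lam).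

Let oO : open Om. Proof. exact: (thin_domain_open K0 lip oo). Qed.

(** The components of the constant gradient of the height. *)
Definition slope i : R := if i == ord0 then 1 else - a i.

Lemma height_slope x i (t : R) : ht (x + t *: e_ i) = ht x + slope i * t.
Proof.
rewrite /slope; case: (unliftP ord0 i) => [j ->|->].
  by rewrite height_line /= mulNr.
by rewrite height_line0 eqxx mul1r.
Qed.

Lemma continuous_height_comp (F : R -> R) : continuous F ->
  cont_closure Om (fun x => F (ht x)).
Proof.
move=> cF; apply: cont_closure_continuous => x.
by apply: (@continuous_comp _ _ _ ht F); [exact: height_continuous|exact: cF].
Qed.

Let cht : cont_closure Om ht.
Proof. exact/cont_closure_continuous/height_continuous. Qed.

Let cth : cont_closure Om th.
Proof. exact/cont_closure_continuous/(thickness_continuous K0 lip). Qed.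

Let cw : cont_closure Om (fun x => strip_weight h (ht x)).
Proof. by apply: continuous_height_comp; case: (strip_continuous h). Qed.

Let cw1 : cont_closure Om (fun x => strip_weight1 h (ht x)).
Proof. by apply: continuous_height_comp; case: (strip_continuous h). Qed.

Let cw2 : cont_closure Om (fun x => strip_weight2 h (ht x)).
Proof. by apply: continuous_height_comp; case: (strip_continuous h). Qed.

Let cwp : cont_closure Om (fun x => strip_primitive h (ht x)).
Proof. by apply: continuous_height_comp; case: (strip_continuous h). Qed.

Lemma lateral_boundary_inside x : closure Om x -> ~ Om x -> 0 < ht x < th x ->
  lateral_boundary omega a psi x.
Proof.
move=> cx nx hx.
have := @lateral_boundary_line _ _ _ _ _ _ K0 lip oo x 0 cx nx hx.
by rewrite scale0r !addr0; apply.
Qed.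

(** At height 0 or at least [h] the weights vanish; in between, since [h <= T], the point is on the
    lateral boundary and [u] vanishes. *)
Lemma strip_boundary x : closure Om x -> ~ Om x ->
  strip_weight h (ht x) * U [::] x = 0 /\ strip_weight1 h (ht x) * U [::] x = 0.
Proof.
move=> cx nx.
have [_ /andP[s0 sT]] := closure_thin_domain K0 lip cx.
have /andP[hTx _] := hT cx.
have [hs|sh] := leP h (ht x).
  by have [-> ->] := strip_weight_eq0 h0 (or_intror hs); rewrite !mul0r.
have [s00|sn0] := eqVneq (ht x) 0.
  by have [-> ->] := strip_weight_eq0 h0 (or_introl s00); rewrite !mul0r.
rewrite lat ?mulr0//; apply: lateral_boundary_inside => //.
by rewrite lt_def sn0 s0 (lt_le_trans sh).
Qed.

(** [E1] integrates the derivative of [w u u_i], [E2] that of [w' u^2], and [E3] is the equation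
    tested against [w u]. Summing [E1] with weights [b i] cancels the second derivatives and leaves
    the cross terms [I_ i]. *)
Lemma strip_energy :
  \sum_i b i * J (fun x => strip_weight h (ht x) * U [:: i] x ^+ 2) =
  - (\sum_i b i * slope i ^+ 2) *
    J (fun x => strip_weight1 h (ht x) * U [::] x * U [:: ord0] x).
Proof.
have [cU dU] := jet.
have c0 := cU [::] isT.
have c1 i := cU [:: i] isT.
have c2 i := cU [:: i; i] isT.
pose X i := J (fun x => strip_weight h (ht x) * U [:: i] x ^+ 2).
pose Y i := J (fun x => strip_weight h (ht x) * U [::] x * U [:: i; i] x).
pose I_ i := J (fun x => strip_weight1 h (ht x) * U [::] x * U [:: i] x).
pose Z := J (fun x => strip_weight2 h (ht x) * U [::] x ^+ 2).
have dw i x : is_derive x (e_ i) (fun y => strip_weight h (ht y))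
    (slope i * strip_weight1 h (ht x)).
  apply: is_derive_comp_affine (is_derive_strip_weight h _) => t.
  exact: height_slope.
have dw1 i x : is_derive x (e_ i) (fun y => strip_weight1 h (ht y))
    (slope i * strip_weight2 h (ht x)).
  apply: is_derive_comp_affine (is_derive_strip_weight1 h _) => t.
  exact: height_slope.
have E1 i : slope i * I_ i + X i + Y i = 0.
  have k1 := cont_closureM (cont_closureM cw1 c0) (c1 i).
  have k1' := cont_closureM (@cont_closure_cst _ _ Om (slope i)) k1.
  have k2 := cont_closureM cw (@cont_closureX _ _ Om _ 2 (c1 i)).
  have k3 := cont_closureM (cont_closureM cw c0) (c2 i).
  rewrite /I_ -(cont_integralZ oO OB (slope i) k1) -(cont_integralD oO OB k1' k2).
  rewrite -(cont_integralD oO OB (cont_closureD k1' k2) k3).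
  apply: (slice_derivative_eq0 oO OB (i := i)
    (G := fun x => strip_weight h (ht x) * U [::] x * U [:: i] x)).
  - exact: (cont_closureM (cont_closureM cw c0) (c1 i)).
  - exact: (cont_closureD (cont_closureD k1' k2) k3).
  - move=> x Ox.
    have d1 := is_derive_mul (is_derive_mul (dw i x) (dU [::] i x isT Ox))
      (dU [:: i] i x isT Ox).
    by apply: (is_derive_eq d1); ring.
  - by move=> x t /closure_slice ct nt; rewrite (strip_boundary ct nt).1 mul0r.
have E2 i : slope i * Z + 2 * I_ i = 0.
  have k1 := cont_closureM (cont_closureM cw1 c0) (c1 i).
  have k2 := cont_closureM cw2 (@cont_closureX _ _ Om _ 2 c0).
  have k1' := cont_closureM (@cont_closure_cst _ _ Om 2) k1.
  have k2' := cont_closureM (@cont_closure_cst _ _ Om (slope i)) k2.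
  rewrite /I_ -(cont_integralZ oO OB 2 k1) -(cont_integralZ oO OB (slope i) k2).
  rewrite -(cont_integralD oO OB k2' k1').
  apply: (slice_derivative_eq0 oO OB (i := i)
    (G := fun x => strip_weight1 h (ht x) * U [::] x * U [::] x)).
  - exact: (cont_closureM (cont_closureM cw1 c0) c0).
  - exact: (cont_closureD k2' k1').
  - move=> x Ox.
    have d1 := is_derive_mul (is_derive_mul (dw1 i x) (dU [::] i x isT Ox))
      (dU [::] i x isT Ox).
    by apply: (is_derive_eq d1); ring.
  - by move=> x t /closure_slice ct nt; rewrite (strip_boundary ct nt).2 mul0r.
have E3 : \sum_i b i * Y i = 0.
  have k i := cont_closureM (cont_closureM cw c0) (c2 i).
  have k' i := cont_closureM (@cont_closure_cst _ _ Om (b i)) (k i).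
  transitivity (\sum_i J (fun x => b i *
      (strip_weight h (ht x) * U [::] x * U [:: i; i] x))).
    by apply: eq_bigr => i _; rewrite (cont_integralZ oO OB (b i) (k i)).
  rewrite -(cont_integral_sum oO OB _ k').
  apply: (cont_integral0 oO OB) => x Ox.
  transitivity (strip_weight h (ht x) * U [::] x * \sum_i b i * U [:: i; i] x).
    by rewrite mulr_sumr; apply: eq_bigr => i _; ring.
  by rewrite eqn// mulr0.
(* [Z] is independent of the direction and is eliminated between [E2 i] and [E2 ord0]. *)
have I0 i : I_ i = slope i * I_ ord0.
  have := E2 i; have := E2 ord0; rewrite {1}/slope eqxx mul1r => h1 h2.
  have -> : I_ i = (slope i * Z + 2 * I_ i) / 2 - slope i * (Z + 2 * I_ ord0) / 2
    + slope i * I_ ord0 by field.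
  by rewrite h1 h2; ring.
transitivity (- \sum_i b i * (slope i * I_ i) - \sum_i b i * Y i); last first.
  rewrite E3 subr0 mulNr mulr_suml; congr (- _).
  by apply: eq_bigr => i _; rewrite I0 -/(I_ ord0); ring.
rewrite -opprD -big_split /= -sumrN; apply: eq_bigr => i _.
rewrite -/(X i); have -> : X i = slope i * I_ i + X i + Y i - (slope i * I_ i + Y i) by ring.
by rewrite E1; ring.
Qed.

Definition wall_distance x := Num.min (ht x) (th x - ht x).

Let crho : cont_closure Om wall_distance.
Proof.
apply: cont_closure_continuous => x.
apply: (@continuous_min _ _ ht (fun x => th x - ht x)).
  exact: height_continuous.
by have := @gap_cvg _ _ a psi _ K0 lip x.
Qed.

Variable S : R.
Hypothesis slopeS : forall i, `|slope i| <= S.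

(** [S] bounds the variation of the height and [K + affine_lip a] that of the thickness; the total
    covers both branches of the minimum and the switches between them. *)
Definition wall_lip : R := 2 * S + K + affine_lip a.

Lemma wall_distance_lip x i (t : R) :
  `|wall_distance (x + t *: e_ i) - wall_distance x| <= wall_lip * `|t|.
Proof.
have S0 : 0 <= S by rewrite (le_trans _ (slopeS i)).
have h1 : `|ht (x + t *: e_ i) - ht x| <= S * `|t|.
  by rewrite height_slope addrAC subrr add0r normrM ler_wpM2r.
have h2 : `|th (x + t *: e_ i) - th x| <= (K + affine_lip a) * `|t|.
  rewrite (le_trans (thickness_lipschitz a K0 lip _ _))// addrAC subrr add0r.
  rewrite ler_wpM2l ?addr_ge0 ?affine_lip_ge0// normrZ ler_piMr//.
  apply: rV_norm_le => // j.
  by rewrite mxE; case: (_ == _); case: (_ == _); rewrite /= ?normr1 ?normr0.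
rewrite /wall_distance /wall_lip !mulrDl -!mulrA.
move: h1 h2; rewrite mulrDl; set St := S * _; set Kt := K * _; set At := affine_lip a * _.
rewrite !ler_norml => /andP[a1 a2] /andP[a3 a4].
by rewrite /Num.min; do 2 case: ifP => ?; apply/andP; split; lra.
Qed.

Lemma jet_swap i j x : Om x -> U [:: i; j] x = U [:: j; i] x.
Proof. exact: (closure_jet_swap i j oO jet (s := [::])). Qed.

(** The equation is differentiated vertically. Moving [ord0] past both [i] takes two swaps: one of
    the outer derivatives at [x], and one of the inner derivatives, valid on all of [Om] and then
    differentiated. *)
Lemma vertical_derivative_solution x : Om x ->
  \sum_i b i * U [:: i; i; ord0] x = 0.
Proof.
move=> Ox; have [cU dU] := jet.
have nO : nbhs x Om by exact: open_nbhs_nbhs.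
have E i : U [:: i; i; ord0] x = U [:: ord0; i; i] x.
  rewrite -(closure_jet_swap i ord0 oO jet (s := [:: i]) isT Ox).
  apply: (is_derive_unique (dU [:: i; ord0] i x isT Ox)).
  apply: near_eq_is_derive (dU [:: ord0; i] i x isT Ox).
  by apply: filterS nO => y Oy; exact: jet_swap.
under eq_bigr do rewrite E.
have d1 : is_derive x (e_ ord0) (fun y => \sum_i b i * U [:: i; i] y)
    (\sum_i b i * U [:: ord0; i; i] x).
  apply: is_derive_bigsum => i.
  have d2 := is_derive_mul (is_derive_const x (e_ ord0) (b i)) (dU [:: i; i] ord0 x isT Ox).
  by apply: (is_derive_eq d2); rewrite mul0r add0r.
apply: (is_derive_unique d1).
apply: near_eq_is_derive (is_derive_const x (e_ ord0) 0).
by apply: filterS nO => y Oy; rewrite eqn.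
Qed.

Lemma wall_distance_ge0 x : Om x -> 0 <= wall_distance x.
Proof.
move=> /thin_domainP[_ /andP[p0 p1]].
by rewrite /wall_distance le_min (ltW p0) subr_ge0 ltW.
Qed.

(** The two factors share the boundary: [u_1] vanishes on its lateral part, the distance on the
    faces. *)
Lemma wall_boundary x : closure Om x -> ~ Om x -> U [:: ord0] x * wall_distance x = 0.
Proof.
have [cU dU] := jet.
move=> cx nx; have [_ /andP[s0 sT]] := closure_thin_domain K0 lip cx.
have [hx|nhx] := boolP (0 < ht x < th x).
  rewrite (@vertical_derivative_lateral_eq0 _ _ _ _ _ _ K0 lip oo
    (U [::]) (U [:: ord0]) _ _ _ lat x cx nx hx) ?mul0r//.
  - exact: (cU [::] isT).
  - exact: (cU [:: ord0] isT).
  - by move=> y Oy; exact: (dU [::] ord0 y isT Oy).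
suff -> : wall_distance x = 0 by rewrite mulr0.
move: nhx; rewrite negb_and -!leNgt /wall_distance /Num.min.
by case: ifP => ?; move=> /orP[] ?; lra.
Qed.

(** Caccioppoli's inequality, proved direction by direction. The terms [T i] cancel only in the sum
    weighted by [b i], which preserves the inequalities [key i] because [b i] is nonnegative. *)
Lemma interior_energy :
  \sum_i J (fun x => wall_distance x ^+ 2 * U [:: i; ord0] x ^+ 2) <=
  4 * wall_lip ^+ 2 * (d.+1%:R * Lam) / lam * J (fun x => U [:: ord0] x ^+ 2).
Proof.
have [cU dU] := jet.
have cv := cU [:: ord0] isT.
have c1 i := cU [:: i; ord0] isT.
have c2 i := cU [:: i; i; ord0] isT.
pose P i := J (fun x => wall_distance x ^+ 2 * U [:: i; ord0] x ^+ 2).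
pose T i := J (fun x => wall_distance x ^+ 2 * U [:: ord0] x * U [:: i; i; ord0] x).
pose V := J (fun x => U [:: ord0] x ^+ 2).
have V0 : 0 <= V by apply: cont_integral_ge0 => x _; exact: sqr_ge0.
have Kr0 : 0 <= wall_lip.
  have S0 : 0 <= S by rewrite (le_trans _ (slopeS ord0)).
  by rewrite /wall_lip !addr_ge0 ?mulr_ge0 ?affine_lip_ge0.
set Kr := wall_lip in Kr0 *.
have cr2 := @cont_closureX _ _ Om _ 2 crho.
have key i : 0 <= (- 2^-1) * P i + 2 * Kr ^+ 2 * V + (-1) * T i.
  have k1 := cont_closureM cr2 (@cont_closureX _ _ Om _ 2 (c1 i)).
  have k1' := cont_closureM (@cont_closure_cst _ _ Om (- 2^-1)) k1.
  have k2 := @cont_closureX _ _ Om _ 2 cv.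
  have k2' := cont_closureM (@cont_closure_cst _ _ Om (2 * Kr ^+ 2)) k2.
  have k3 := cont_closureM (cont_closureM cr2 cv) (c2 i).
  have k3' := cont_closureM (@cont_closure_cst _ _ Om (-1)) k3.
  have cG := cont_closureN (cont_closureM cv (c1 i)).
  have cg := cont_closureN (cont_closureD (cont_closureM (c1 i) (c1 i))
    (cont_closureM cv (c2 i))).
  (* The sign in [G = - v v_i] makes the one-sided inequality bound the integral of [rho^2 v_i^2]
     from above. *)
  have := @slice_product_ge0 _ _ Om B oO OB i
    (fun x => - (U [:: ord0] x * U [:: i; ord0] x))
    (fun x => - (U [:: i; ord0] x * U [:: i; ord0] x + U [:: ord0] x * U [:: i; i; ord0] x))
    wall_distance Kr Kr0 cG cg crho.
  move=> /(_ _ _ _ _)/wrap[].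
  - by move=> x t; exact: wall_distance_lip.
  - exact: wall_distance_ge0.
  - move=> x Ox; apply: is_derive_opp.
    exact: (is_derive_mul (dU [:: ord0] i x isT Ox) (dU [:: i; ord0] i x isT Ox)).
  - move=> x t /closure_slice ct nt.
    by rewrite mulNr mulrAC (wall_boundary ct nt) mul0r oppr0.
  move=> H; apply: (le_trans H).
  rewrite /P /V /T -(cont_integralZ oO OB (- 2^-1) k1).
  rewrite -(cont_integralZ oO OB (2 * Kr ^+ 2) k2) -(cont_integralZ oO OB (-1) k3).
  rewrite -(cont_integralD oO OB k1' k2') -(cont_integralD oO OB (cont_closureD k1' k2') k3').
  apply: (le_cont_integral oO OB).
  - exact: (cont_closureD (cont_closureM cg cr2) (cont_closureM
      (cont_closureM (@cont_closure_cst _ _ Om (2 * Kr)) crho) (cont_closure_norm cG))).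
  - exact: (cont_closureD (cont_closureD k1' k2') k3').
  - move=> x Ox; have r0 := wall_distance_ge0 Ox.
    rewrite normrN normrM.
    move: (U [:: i; i; ord0] x) (wall_distance x) r0 => vii r r0.
    have := real_normK (num_real (U [:: ord0] x)).
    have := real_normK (num_real (U [:: i; ord0] x)).
    move: (U [:: i; ord0] x) (U [:: ord0] x) => vi v.
    move: `|vi| `|v| => nvi nv Evi Ev.
    rewrite -Evi -Ev -subr_ge0.
    (* Young's inequality as a completed square; the last term is zero since [nvi] is the absolute
       value of [vi]. *)
    have -> : - 2^-1 * (r ^+ 2 * nvi ^+ 2) + 2 * Kr ^+ 2 * nv ^+ 2 + -1 * (r ^+ 2 * v * vii)
      - (- (vi * vi + v * vii) * r ^+ 2 + 2 * Kr * r * (nv * nvi)) =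
      2^-1 * (r * nvi - 2 * Kr * nv) ^+ 2 + r ^+ 2 * (vi ^+ 2 - nvi ^+ 2) by field.
    by rewrite Evi subrr mulr0 addr0 mulr_ge0 ?sqr_ge0// invr_ge0.
have T0 : \sum_i b i * T i = 0.
  have k i := cont_closureM (cont_closureM cr2 cv) (c2 i).
  have k' i := cont_closureM (@cont_closure_cst _ _ Om (b i)) (k i).
  transitivity (\sum_i J (fun x => b i *
      (wall_distance x ^+ 2 * U [:: ord0] x * U [:: i; i; ord0] x))).
    by apply: eq_bigr => i _; rewrite (cont_integralZ oO OB (b i) (k i)).
  rewrite -(cont_integral_sum oO OB _ k').
  apply: (cont_integral0 oO OB) => x Ox.
  transitivity (wall_distance x ^+ 2 * U [:: ord0] x * \sum_i b i * U [:: i; i; ord0] x).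
    by rewrite mulr_sumr; apply: eq_bigr => i _; ring.
  by rewrite vertical_derivative_solution// mulr0.
have P0 i : 0 <= P i.
  by apply: cont_integral_ge0 => x _; rewrite mulr_ge0 ?sqr_ge0.
have b0 i : 0 <= b i by have /andP[/(lt_le_trans lam0)/ltW] := bl i.
have sum0 : \sum_i b i * P i <= 4 * Kr ^+ 2 * V * \sum_i b i.
  rewrite -subr_ge0.
  have -> : 4 * Kr ^+ 2 * V * \sum_i b i - \sum_i b i * P i =
    2 * \sum_i b i * ((- 2^-1) * P i + 2 * Kr ^+ 2 * V + (-1) * T i).
    transitivity (4 * Kr ^+ 2 * V * \sum_i b i - \sum_i b i * P i -
      2 * \sum_i b i * T i); first by rewrite T0 mulr0 subr0.
    rewrite !mulr_sumr -!sumrN -!big_split; apply: eq_bigr => i _ /=; by field.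
  by apply: mulr_ge0 => //; apply: sumr_ge0 => i _; apply: mulr_ge0; [exact: b0|exact: key].
have sb : \sum_i b i <= d.+1%:R * Lam.
  apply: (@le_trans _ _ (\sum_(i < d.+1) Lam)).
    by apply: ler_sum => i _; have /andP[] := bl i.
  by rewrite sumr_const card_ord mulr_natl.
have lP : lam * \sum_i P i <= \sum_i b i * P i.
  rewrite mulr_sumr; apply: ler_sum => i _; rewrite ler_wpM2r//.
  by have /andP[] := bl i.
rewrite -/V (_ : _ / lam * V = 4 * Kr ^+ 2 * V * (d.+1%:R * Lam) / lam); last first.
  by field; rewrite gt_eqF.
rewrite ler_pdivlMr// mulrC; apply: le_trans lP _; apply: le_trans sum0 _.
by apply: ler_wpM2l => //; rewrite mulr_ge0// mulr_ge0// sqr_ge0.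
Qed.

(** With [f = u_i] and the vertical field [k], the vertical derivative of [k f^2] integrates to 0.
    Its part [k' f^2] dominates [f^2] up to a multiple of the weight [w], and [2 k f f_1] is
    absorbed by half of [f^2], since [|k|] is at most a multiple of [rho]. *)
Lemma Hardy_vertical i : J (fun x => U [:: i] x ^+ 2) <=
  280 * m / h ^+ 6 * J (fun x => strip_weight h (ht x) * U [:: i] x ^+ 2) +
  4 * (1 + 140 * m) ^+ 2 *
    J (fun x => wall_distance x ^+ 2 * U [:: i; ord0] x ^+ 2).
Proof.
have [cU dU] := jet.
have cf := cU [:: i] isT.
have cf0 := cU [:: ord0; i] isT.
have c1 := cU [:: i; ord0] isT.
pose k x := vertical_field h (th x) (ht x).
pose k' x := 1 - 140 * th x / h ^+ 7 * strip_weight h (ht x).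
have ch7 : cont_closure Om (fun x => 140 * th x / h ^+ 7).
  exact: (cont_closureM (cont_closureM (@cont_closure_cst _ _ Om 140) cth)
    (@cont_closure_cst _ _ Om (h ^+ 7)^-1)).
have ck : cont_closure Om k.
  exact: (cont_closureD (cont_closureB cht cth) (cont_closureM ch7 cwp)).
have ck' : cont_closure Om k'.
  exact: (cont_closureB (@cont_closure_cst _ _ Om 1) (cont_closureM ch7 cw)).
have dk x : is_derive x (e_ ord0) k (k' x).
  apply: (@is_derive_eq_line _ _ (fun y => vertical_field h (th x) (ht y))) => [t|].
    by rewrite /k thickness_line0.
  rewrite -[k' x]mul1r.
  apply: is_derive_comp_affine (is_derive_vertical_field h (th x) _) => t.
  by rewrite height_line0 mul1r.
have G0 : J (fun x => (k' x * U [:: i] x + k x * U [:: ord0; i] x) * U [:: i] x +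
    k x * U [:: i] x * U [:: ord0; i] x) = 0.
  apply: (slice_derivative_eq0 oO OB (i := ord0)
    (G := fun x => k x * U [:: i] x * U [:: i] x)).
  - exact: (cont_closureM (cont_closureM ck cf) cf).
  - exact: (cont_closureD (cont_closureM (cont_closureD (cont_closureM ck' cf)
      (cont_closureM ck cf0)) cf) (cont_closureM (cont_closureM ck cf) cf0)).
  - move=> x Ox.
    exact: (is_derive_mul (is_derive_mul (dk x) (dU [:: i] ord0 x isT Ox))
      (dU [:: i] ord0 x isT Ox)).
  (* A point in the closure of a vertical slice has the same [x'] as a point of [Om], so it lies on
     a face, where [k] vanishes; nothing is asked of [f]. *)
  - move=> x t ct nt.
    suff -> : k (x + t *: e_ ord0) = 0 by rewrite !mul0r.
    have [s [Os _]] := ct _ (nbhsx_ballx t 1 ltr01).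
    move: (closure_slice ct) nt => cy ny.
    have /thin_domainP[ox _] : Om (x + s *: e_ ord0) := Os.
    have [_ /andP[y0 yT]] := closure_thin_domain K0 lip cy.
    have /andP[hTy _] := hT cy.
    have ny' : ~ (0 < ht (x + t *: e_ ord0) < th (x + t *: e_ ord0)).
      move=> hy; apply: ny; apply/thin_domainP; split => //.
      by move: ox; rewrite !col'_line0.
    have [y00|yn0] := eqVneq (ht (x + t *: e_ ord0)) 0.
      by rewrite /k y00 vertical_field0.
    have -> : k (x + t *: e_ ord0) = vertical_field h (th (x + t *: e_ ord0))
        (th (x + t *: e_ ord0)).
      rewrite /k; congr vertical_field; apply/eqP; rewrite eq_le yT /= leNgt.
      by apply/negP => lt; apply: ny'; rewrite lt lt_def yn0 y0.
    exact: vertical_fieldT.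
have k1 := @cont_closureX _ _ Om _ 2 cf.
have k2 := cont_closureM cw k1.
have k3 := cont_closureM (@cont_closureX _ _ Om _ 2 crho) (@cont_closureX _ _ Om _ 2 cf0).
set D := 140 * m / h ^+ 6.
set B' := 1 + 140 * m.
have k1' := cont_closureM (@cont_closure_cst _ _ Om 2^-1) k1.
have k2' := cont_closureM (@cont_closure_cst _ _ Om (- D)) k2.
have k3' := cont_closureM (@cont_closure_cst _ _ Om (- (2 * B' ^+ 2))) k3.
(* The inequality produces [(u_i)_1], whereas Caccioppoli bounds [(u_1)_i]. *)
have E : J (fun x => wall_distance x ^+ 2 * U [:: i; ord0] x ^+ 2) =
    J (fun x => wall_distance x ^+ 2 * U [:: ord0; i] x ^+ 2).
  by apply: eq_cont_integral => x Ox; rewrite jet_swap.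
suff : 2^-1 * J (fun x => U [:: i] x ^+ 2) +
    (- D) * J (fun x => strip_weight h (ht x) * U [:: i] x ^+ 2) +
    (- (2 * B' ^+ 2)) * J (fun x => wall_distance x ^+ 2 * U [:: ord0; i] x ^+ 2) <= 0.
  rewrite E (_ : 280 * m / h ^+ 6 = 2 * D); last by rewrite /D; ring.
  by lra.
rewrite -G0 -(cont_integralZ oO OB 2^-1 k1) -(cont_integralZ oO OB (- D) k2).
rewrite -(cont_integralZ oO OB (- (2 * B' ^+ 2)) k3).
rewrite -(cont_integralD oO OB k1' k2') -(cont_integralD oO OB (cont_closureD k1' k2') k3').
apply: (le_cont_integral oO OB).
- exact: (cont_closureD (cont_closureD k1' k2') k3').
- exact: (cont_closureD (cont_closureM (cont_closureD (cont_closureM ck' cf)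
      (cont_closureM ck cf0)) cf) (cont_closureM (cont_closureM ck cf) cf0)).
move=> x Ox.
have cx := subset_closure Ox.
have [_ hs] := closure_thin_domain K0 lip cx.
have hTx := hT cx.
have kB : `|k x| <= B' * wall_distance x := vertical_field_bound h0 hTx hs.
have /andP[w0 _] := strip_weight_bounds h0 (andP hs).1.
have k'B : 1 - D * strip_weight h (ht x) <= k' x.
  rewrite /k' lerD2l lerN2 ler_wpM2r// /D.
  have -> : 140 * m / h ^+ 6 = 140 * (m * h) / h ^+ 7 by field; rewrite gt_eqF.
  apply: ler_wpM2r; first by rewrite invr_ge0 exprn_ge0// ltW.
  by apply: ler_wpM2l => //; case/andP: hTx.
have kB2 : k x ^+ 2 <= B' ^+ 2 * wall_distance x ^+ 2.
  rewrite -exprMn -[k x ^+ 2]real_normK ?num_real//.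
  by apply: lerXn2r; rewrite ?nnegrE// (le_trans _ kB).
move: (k x) (k' x) (wall_distance x) (strip_weight h (ht x)) (U [:: i] x)
  (U [:: ord0; i] x) k'B kB2 => kx kx' r w f f0 k'B kB2.
rewrite -subr_ge0.
(* The difference is a sum of three nonnegative terms: the lower bound on [k'], a square, and the
   bound on [k^2]. *)
have -> : (kx' * f + kx * f0) * f + kx * f * f0 -
  (2^-1 * f ^+ 2 + - D * (w * f ^+ 2) + - (2 * B' ^+ 2) * (r ^+ 2 * f0 ^+ 2)) =
  (kx' - (1 - D * w)) * f ^+ 2 + 2^-1 * (f + 2 * kx * f0) ^+ 2 +
  2 * (B' ^+ 2 * r ^+ 2 - kx ^+ 2) * f0 ^+ 2 by field.
have t1 : 0 <= (kx' - (1 - D * w)) * f ^+ 2 by rewrite mulr_ge0 ?sqr_ge0// subr_ge0.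
have t2 : 0 <= 2^-1 * (f + 2 * kx * f0) ^+ 2 by rewrite mulr_ge0 ?sqr_ge0// invr_ge0.
have t3 : 0 <= 2 * (B' ^+ 2 * r ^+ 2 - kx ^+ 2) * f0 ^+ 2.
  by rewrite mulr_ge0 ?sqr_ge0// mulr_ge0// subr_ge0.
by rewrite !addr_ge0.
Qed.

(** The Hardy inequality is summed over all directions. The bound [3 h^5] on [|w'|] against the
    factor [280 m / h^6] gives [840 m / h], and [16] is 4 from Hardy times 4 from Caccioppoli. *)
Lemma gradient_energy : 0 <= m ->
  \sum_i J (fun x => U [:: i] x ^+ 2) <=
  840 * m * (d.+1%:R * Lam * S ^+ 2) / lam / h *
    J (fun x => `|U [::] x * U [:: ord0] x|) +
  16 * (1 + 140 * m) ^+ 2 * wall_lip ^+ 2 * (d.+1%:R * Lam) / lam *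
    J (fun x => U [:: ord0] x ^+ 2).
Proof.
move=> m0; have [cU dU] := jet.
have cu := cU [::] isT.
have cv := cU [:: ord0] isT.
set N := J (fun x => `|U [::] x * U [:: ord0] x|).
set V := J (fun x => U [:: ord0] x ^+ 2).
pose X i := J (fun x => strip_weight h (ht x) * U [:: i] x ^+ 2).
pose P i := J (fun x => wall_distance x ^+ 2 * U [:: i; ord0] x ^+ 2).
have N0 : 0 <= N by apply: cont_integral_ge0.
have w0 x : Om x -> 0 <= strip_weight h (ht x).
  by move=> /thin_domainP[_ /andP[/ltW s0 _]]; have /andP[] := strip_weight_bounds h0 s0.
have X0 i : 0 <= X i.
  by apply: cont_integral_ge0 => x Ox; rewrite mulr_ge0 ?sqr_ge0 ?w0.
have b0 i : 0 <= b i by have /andP[/(lt_le_trans lam0)/ltW] := bl i.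
have S0 : 0 <= S by rewrite (le_trans _ (slopeS ord0)).
have lX : lam * \sum_i X i <= \sum_i b i * X i.
  rewrite mulr_sumr; apply: ler_sum => i _; rewrite ler_wpM2r//.
  by have /andP[] := bl i.
have k1 := cont_closureM (cont_closureM cw1 cu) cv.
have cN := cont_closure_norm (cont_closureM cu cv).
have IN : - J (fun x => strip_weight1 h (ht x) * U [::] x * U [:: ord0] x) <=
    3 * h ^+ 5 * N.
  rewrite -mulN1r -(cont_integralZ oO OB (-1) k1) -(cont_integralZ oO OB (3 * h ^+ 5) cN).
  apply: (le_cont_integral oO OB).
  - exact: (cont_closureM (@cont_closure_cst _ _ Om (-1)) k1).
  - exact: (cont_closureM (@cont_closure_cst _ _ Om (3 * h ^+ 5)) cN).
  - move=> x /thin_domainP[_ /andP[/ltW s0 _]].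
    apply: (le_trans (ler_norm _)).
    rewrite mulN1r normrN -mulrA normrM ler_wpM2r//.
    exact: strip_weight1_bound.
set beta := \sum_i b i * slope i ^+ 2.
have beta0 : 0 <= beta by apply: sumr_ge0 => i _; rewrite mulr_ge0 ?sqr_ge0.
have betaB : beta <= d.+1%:R * Lam * S ^+ 2.
  apply: (@le_trans _ _ (\sum_(i < d.+1) Lam * S ^+ 2)).
    apply: ler_sum => i _; apply: ler_pM => //; first exact: sqr_ge0.
      by have /andP[] := bl i.
    rewrite -[slope i ^+ 2]real_normK ?num_real//.
    by apply: lerXn2r; rewrite ?nnegrE.
  by rewrite sumr_const card_ord -[leLHS]mulr_natl mulrA.
have h5 : 0 <= 3 * h ^+ 5 * N by rewrite mulr_ge0// mulr_ge0// exprn_ge0// ltW.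
have sX : \sum_i X i <= d.+1%:R * Lam * S ^+ 2 * (3 * h ^+ 5 * N) / lam.
  rewrite ler_pdivlMr// mulrC (le_trans lX)// strip_energy -/beta mulNr -mulrN.
  by rewrite (le_trans (ler_wpM2l beta0 IN))// ler_wpM2r.
have := interior_energy; rewrite -/V => sP.
apply: (@le_trans _ _ (\sum_i (280 * m / h ^+ 6 * X i + 4 * (1 + 140 * m) ^+ 2 * P i))).
  by apply: ler_sum => i _; exact: Hardy_vertical.
rewrite big_split /= -!mulr_sumr; apply: lerD.
  have D0 : 0 <= 280 * m / h ^+ 6.
    by apply: divr_ge0; [rewrite mulr_ge0|rewrite exprn_ge0// ltW].
  rewrite (le_trans (ler_wpM2l D0 sX))// le_eqVlt; apply/orP; left; apply/eqP.
  by field; rewrite !gt_eqF.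
have D0 : 0 <= 4 * (1 + 140 * m) ^+ 2 by rewrite mulr_ge0 ?sqr_ge0.
rewrite (le_trans (ler_wpM2l D0 sP))// le_eqVlt; apply/orP; left; apply/eqP.
by field; rewrite gt_eqF.
Qed.

End energy.

(** * Passage to the norms and thicknesses of the statement *)

Section L2norm_integral.
Context {R : realType} {n : nat} (Om : set 'rV[R]_n) (B : R).
Hypotheses (oO : open Om) (OB : Om `<=` box B).

(** [F] extends [f^2] continuously to the closure, which makes the extended-real norm finite and
    lets the jet replace the derivatives of [u]. *)
Lemma L2norm_sqrt (f F : 'rV[R]_n -> R) : cont_closure Om F ->
  (forall x, Om x -> f x ^+ 2 = F x) ->
  L2norm Om f = (Num.sqrt (\int[lebesgue_rV n]_(x in Om) F x))%:E.
Proof.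
move=> cF fF; rewrite /L2norm unlock.
have -> : (\int[lebesgue_rV n]_x `|(EFin \o (f \_ Om)) x| `^ 2 =
    (\int[lebesgue_rV n]_(x in Om) F x)%:E)%E.
  rewrite /Rintegral fineK; last first.
    apply: integrable_fin_num; first exact: rV_open_measurable.
    exact: cont_closure_integrable OB _.
  rewrite [RHS]integral_mkcond; apply: eq_integral => x _.
  rewrite /comp !patchE abse_EFin poweR_EFin powR_mulrn//; case: ifPn => [|_].
    by rewrite inE => Ox; rewrite real_normK ?num_real// fF.
  by rewrite normr0 expr0n.
rewrite poweR_EFin powR12_sqrt//.
by apply: cont_integral_ge0 => x Ox; rewrite -fF// sqr_ge0.
Qed.

End L2norm_integral.

Section thickness_of_domain.
Context {R : realType} {d : nat} (omega : set 'rV[R]_d) (a : 'I_d.+1 -> R).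
Implicit Types phi psi : 'rV[R]_d -> R.

Lemma bounded_set_box : bounded_set omega -> exists M, omega `<=` box M.
Proof.
move=> [M [_ HM]]; exists (M + 1) => y oy i.
have := HM (M + 1) _ y oy; rewrite ltrDl ltr01 => /(_ isT) yM.
by rewrite /= in_itv/= -ler_norml (le_trans (ler_coord_norm _ _)).
Qed.

Lemma affine_continuous : continuous (affine a).
Proof. exact: lipschitz_bound_continuous (affine_lipschitz a). Qed.

Lemma thin_domain_ext phi psi : {in omega, phi =1 psi} ->
  thin_domain omega a phi = thin_domain omega a psi.
Proof.
move=> E; apply/seteqP; split => x [ox]; rewrite ?E ?inE// => hx; split => //.
by rewrite E ?inE.
Qed.

Lemma lateral_boundary_ext phi psi : {in omega, phi =1 psi} ->
  lateral_boundary omega a phi = lateral_boundary omega a psi.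
Proof. by move=> /thin_domain_ext E; rewrite /lateral_boundary E. Qed.

Variables (psi : 'rV[R]_d -> R) (M : R).
Hypotheses (cpsi : continuous psi) (oM : omega `<=` box M).

(** Boundedness of the thickness on [omega] excludes the default values of [sup] and [inf]. *)
Lemma thickness_between y : omega y ->
  min_thickness omega a psi <= psi y - affine a y <= max_thickness omega a psi.
Proof.
move=> oy.
have [N HN] : exists N, forall z, omega z -> `|psi z - affine a z| <= N.
  apply: (cont_closure_bounded oM); apply: cont_closureB.
  - exact: cont_closure_continuous.
  - exact/cont_closure_continuous/affine_continuous.
apply/andP; split.
- apply: ge_inf; last by exists y.
  by exists (- N) => _ [z oz <-]; have := HN z oz; rewrite ler_norml => /andP[].
- apply: ub_le_sup; last by exists y.
  by exists N => _ [z oz <-]; have := HN z oz; rewrite ler_norml => /andP[].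
Qed.

Lemma thin_domain_box : exists B, thin_domain omega a psi `<=` box B.
Proof.
have [N1 H1] := cont_closure_bounded oM (cont_closure_continuous cpsi).
have [N2 H2] := cont_closure_bounded oM (cont_closure_continuous affine_continuous).
exists (`|M| + `|N1| + `|N2|) => x [ox /andP[ax xp]] i.
rewrite /= in_itv/= -ler_norml; case: (unliftP ord0 i) => [j ->|->].
  have := oM ox j; rewrite /= in_itv/= -ler_norml mxE => /le_trans; apply.
  by rewrite -addrA (le_trans (ler_norm _))// lerDl addr_ge0.
have := H1 _ ox; have := H2 _ ox.
have := ler_norm N1; have := ler_norm N2; have := normr_ge0 M.
by rewrite !ler_norml => ? ? ? /andP[? ?] /andP[? ?]; apply/andP; split; lra.
Qed.

End thickness_of_domain.

Theorem theorem1p3 (R : realType) (d : nat) (lambda Lambda L m A : R)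
    (hn : (2 <= d.+1)%N) (hlambda : 0 < lambda) (hLambda : 0 < Lambda)
    (hL : 0 <= L) (hm : 1 <= m) (hA : 0 <= A) :
  exists C : R,
  forall (omega : set 'rV[R]_d) (a : 'I_d.+1 -> R) (phi : 'rV[R]_d -> R)
    (H h : R) (b : 'I_d.+1 -> R) (u : 'rV[R]_d.+1 -> R),
    bounded_lipschitz_domain omega ->
    \big[Num.max/0]_(i < d.+1) `|a i| = A ->
    [lipschitz phi y | y in omega] -> lip_const omega phi = L ->
    H = max_thickness omega a phi ->
    h = min_thickness omega a phi -> 0 < h -> H / h = m ->
    (forall xi : 'rV[R]_d.+1,
       lambda * euclid_norm xi ^+ 2 <=
       \sum_(i < d.+1) b i * xi ord0 i ^+ 2) ->
    (forall j, `|b j| <= Lambda) ->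
    let Omega := thin_domain omega a phi in
    Ck_closure 3 Omega u ->
    (forall x, Omega x -> diag_operator b u x = 0) ->
    (forall x, lateral_boundary omega a phi x -> u x = 0) ->
    (L2norm Omega (fun x => euclid_norm (grad u x)) ^+ 2 <=
     (C / h)%:E * L2norm Omega u * L2norm Omega (partial ord0 u) +
     C%:E * L2norm Omega (partial ord0 u) ^+ 2)%E.
Proof.
(* A bound for [wall_lip] in terms of the data alone, with [S = 1 + A], [K = L * d] and
   [affine_lip a <= d * A]. *)
set W := 2 * (1 + A) + L * d%:R + d%:R * A.
set C1 := 840 * m * (d.+1%:R * Lambda * (1 + A) ^+ 2) / lambda.
set C2 := 16 * (1 + 140 * m) ^+ 2 * W ^+ 2 * (d.+1%:R * Lambda) / lambda.
have m0 : 0 <= m by exact: le_trans hm.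
have W0 : 0 <= W by rewrite /W !addr_ge0 ?mulr_ge0 ?addr_ge0.
have Lam0 : 0 <= d.+1%:R * Lambda by rewrite mulr_ge0// ltW.
have C10 : 0 <= C1.
  apply: divr_ge0; last exact: ltW.
  exact: (mulr_ge0 (mulr_ge0 (ler0n _ 840) m0) (mulr_ge0 Lam0 (sqr_ge0 _))).
have C20 : 0 <= C2.
  apply: divr_ge0; last exact: ltW.
  exact: (mulr_ge0 (mulr_ge0 (mulr_ge0 (ler0n _ 16) (sqr_ge0 _)) (sqr_ge0 _)) Lam0).
exists (C1 + C2) => omega a phi H h b u domega aA lipphi phiL HE hE h0 Hhm ell bL Om
  cku equ latu.
have [om0 oomega _ bomega _] := domega.
have [M oM] := bounded_set_box bomega.
have lipL := lip_const_bound lipphi; rewrite phiL in lipL.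
have K0 : 0 <= L * d%:R by rewrite mulr_ge0.
(* [phi] is controlled on [omega] only; a global Lipschitz extension makes the thickness Lipschitz
   on the whole space without changing the domain. *)
have [psi [psiE lip]] := lipschitz_bound_extension K0 om0 lipL.
have E : {in omega, phi =1 psi} by move=> y; rewrite inE => oy; rewrite psiE.
have cpsi := lipschitz_bound_continuous lip.
have OmE : Om = thin_domain omega a psi by exact: thin_domain_ext.
have latE := lateral_boundary_ext a E.
have tE : [set phi y - affine a y | y in omega] = [set psi y - affine a y | y in omega].
  by apply: eq_imagel => y oy; rewrite psiE.
have hH y : omega y -> h <= psi y - affine a y <= H.
  by move=> oy; rewrite hE HE /min_thickness /max_thickness tE (thickness_between a cpsi oM oy).
have HmE : H = m * h by rewrite -Hhm mulfVK// gt_eqF.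
rewrite HmE in hH.
have [B OB] := thin_domain_box a cpsi oM.
have oO := thin_domain_open (a := a) K0 lip oomega.
rewrite {}OmE in cku equ *; rewrite {}latE in latu; clear Om.
set Om := thin_domain omega a psi in OB oO cku equ latu *.
have [U [jet U0 UE]] := Ck_closure_jet oO cku.
have [cU dU] := jet.
have hT x : closure Om x -> h <= thickness a psi x <= m * h.
  exact: (thickness_bounds K0 lip hH).
have lat x : lateral_boundary omega a psi x -> U [::] x = 0.
  by move=> lx; rewrite U0 ?latu//; have [[]] := lx.
have eqn x : Om x -> \sum_i b i * U [:: i; i] x = 0.
  move=> Ox; rewrite -[RHS](equ x Ox) /diag_operator; apply: eq_bigr => i _.
  by rewrite UE.
have bl i : lambda <= b i <= Lambda.
  apply/andP; split; last by rewrite (le_trans (ler_norm _)).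
  (* Ellipticity tested on the basis vector [e_i]. *)
  have := ell (delta_mx ord0 i); rewrite euclid_norm_sqr (bigD1 i)//= mxE !eqxx expr1n.
  rewrite big1 => [|j ji]; last by rewrite mxE eqxx (negbTE ji) expr0n.
  rewrite addr0 mulr1 (bigD1 i)//= mxE !eqxx expr1n mulr1 big1 ?addr0// => j ji.
  by rewrite mxE eqxx (negbTE ji) expr0n mulr0.
have aleA i : `|a i| <= A by rewrite -aA; exact: (le_bigmax _ (fun i => `|a i|)).
have slopeS i : `|slope a i| <= 1 + A.
  rewrite /slope; case: ifP => _; first by rewrite normr1 lerDl.
  by rewrite normrN (le_trans (aleA i))// lerDr.
have wW : wall_lip a (L * d%:R) (1 + A) <= W.
  rewrite /wall_lip /W lerD2l /affine_lip.
  apply: (@le_trans _ _ (\sum_(i < d) A)); first exact: ler_sum.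
  by rewrite sumr_const card_ord mulr_natl.
have wl0 : 0 <= wall_lip a (L * d%:R) (1 + A).
  by rewrite /wall_lip !addr_ge0 ?affine_lip_ge0// mulr_ge0// addr_ge0.
have := gradient_energy K0 lip oomega OB h0 hT jet lat eqn hlambda bl slopeS m0.
rewrite -/Om -/C1; set N := \int[_]_(x in Om) `|_|.
set V := \int[_]_(x in Om) (U [:: ord0] x ^+ 2) => main.
have V0 : 0 <= V by apply: cont_integral_ge0 => x _; exact: sqr_ge0.
set V' := \int[lebesgue_rV d.+1]_(x in Om) (U [::] x ^+ 2).
have cs : N <= Num.sqrt V' * Num.sqrt V.
  by apply: (cont_integral_Cauchy_Schwarz oO OB); apply: cU.
have normu : L2norm Om u = (Num.sqrt V')%:E.
  apply: (L2norm_sqrt oO OB); first by apply: cont_closureX; exact: cU.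
  by move=> x Ox; rewrite UE.
have normv : L2norm Om (partial ord0 u) = (Num.sqrt V)%:E.
  apply: (L2norm_sqrt oO OB); first by apply: cont_closureX; exact: cU.
  by move=> x Ox; rewrite UE.
pose F x := \sum_i U [:: i] x ^+ 2.
have cF : cont_closure Om F.
  by apply: cont_closure_sum => i; apply: cont_closureX; exact: cU.
have normg : L2norm Om (fun x => euclid_norm (grad u x)) =
    (Num.sqrt (\int[lebesgue_rV d.+1]_(x in Om) F x))%:E.
  apply: (L2norm_sqrt oO OB) => // x Ox; rewrite euclid_norm_sqr.
  by apply: eq_bigr => i _; rewrite mxE UE.
rewrite normg normu normv -!EFin_expe -!EFinM -EFinD lee_fin.
rewrite !sqr_sqrtr//; last first.
  by apply: cont_integral_ge0 => x _; apply: sumr_ge0 => i _; exact: sqr_ge0.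
rewrite (cont_integral_sum oO OB) => [|i]; last by apply: cont_closureX; exact: cU.
apply: (le_trans main).
have hi : 0 <= h^-1 by rewrite invr_ge0 ltW.
apply: lerD.
  rewrite -[leRHS]mulrA; apply: ler_pM => //.
  - exact: mulr_ge0.
  - exact: cont_integral_ge0.
  - by apply: ler_wpM2r => //; rewrite lerDl.
apply: ler_wpM2r => //; apply: (@le_trans _ _ C2); last by rewrite lerDr.
rewrite /C2; apply: ler_wpM2r; first by rewrite invr_ge0 ltW.
apply: ler_wpM2r; first by rewrite mulr_ge0// ltW.
apply: ler_wpM2l; first by rewrite mulr_ge0// sqr_ge0.
exact: lerXn2r.
Qed.
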